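(* There exist absolute constants $C,\eta>0$ such that the following holds. Let $t\ge 3$ be an integer, and let $a,b,c,g$ be elements of $\mathbb{Z}/2^t\mathbb{Z}$, identified with integers in the least residue system modulo $2^t$, with $\gcd(g,2)=\gcd(a,2)=1$ and $b\equiv 0 \bmod 2$. Let $\tau$ be the multiplicative order of $g$ modulo $2^t$, and write $$g^2=1+w_\beta 2^\beta,\qquad \gcd(w_\beta,2)=1,$$ with integers $\beta$ and $w_\beta$. Let the sequence $(u_n)_{n\ge 0}$ in $\mathbb{Z}/2^t\mathbb{Z}$ be given by $$u_n=\frac{a}{g^n-b}+c .$$ Then for every integer $L\ge 0$, every integer $N$ with $2^{8\beta}<N\le \tau$, and every integer $h$ with $\gcd(h,2)=1$, we have $$\left|S_h(L,N)\right|\le C\,N^{1-\eta\rho^2},\qquad\text{where } \rho=\frac{\log N}{t}.$$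
   Context: For a real number $z$, $\mathbf{e}(z)=\exp(2\pi i z)$, and $\log$ is the natural logarithm. The division in the definition of $u_n$ is in the ring $\mathbb{Z}/2^t\mathbb{Z}$; it makes sense since $g^n-b$ is odd, hence a unit. For integers $h$, $L$ and $1\le N\le\tau$, $$S_h(L,N)=\sum_{n=L}^{L+N-1}\mathbf{e}\left(h u_n/2^t\right),$$ where $u_n$ is identified with its representative in the least residue system modulo $2^t$. *)

(* Defs.v *)
From mathcomp Require Import all_boot all_order all_algebra.
From mathcomp Require Import complex.
From mathcomp Require Import reals sequences exp trigo.

Set Implicit Arguments.
Unset Strict Implicit.
Unset Printing Implicit Defensive.

Import Order.TTheory GRing.Theory Num.Theory.

Local Open Scope ring_scope.
Local Open Scope complex_scope.

Definition cexp (R : realType) (z : R[i]) : R[i] :=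
  (expR (complex.Re z))%:C * (cos (complex.Im z) +i* sin (complex.Im z)).

Definition e (R : realType) (z : R) : R[i] := cexp (2 * pi%:C * 'i%C * z%:C).

(* The type 'Z_m is the ring of residues mod m only for m > 1; here it is used
   with m = 2 ^ t and t >= 3. The inverse of a unit of 'Z_m is its inverse in
   this ring, and the coercion from 'Z_m to nat is the least residue mod m. *)
Definition useq (t : nat) (a b c g : 'Z_(2 ^ t)) (n : nat) : 'Z_(2 ^ t) :=
  a / (g ^+ n - b) + c.

Definition expsum (R : realType) (t : nat) (a b c g : 'Z_(2 ^ t)) (h : int)
    (L N : nat) : R[i] :=
  \sum_(L <= n < L + N)
    e (h%:~R * (useq a b c g n : nat)%:R / 2 ^+ t : R).

(* Main.v *)
Require Import Defs.
From mathcomp Require Import all_boot all_order all_algebra.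
From mathcomp Require Import complex.
From mathcomp Require Import reals sequences exp trigo.
From mathcomp Require Import algC cyclotomic ring lra zify.

(** A shift of [n] by [2 ^ (s - beta + 1) * x * y] turns [h * u_n / 2 ^ t], up
    to a constant, into a polynomial in [x * y] whose [j]-th coefficient is an
    odd multiple of [2 ^ (s j - v_2(j!)) / 2 ^ t]; only the degrees up to
    [k ~ t / s] matter. This comes from expanding [1 / (g ^ n G ^ z - b)] as a
    2-adically convergent geometric series, [b] being even, and
    [G ^ - z = (1 + 2 ^ s v) ^ z] by the binomial theorem.

    Averaging over [x, y < P], with [P ~ 2 ^ (2 s)], and applying Hölder's
    inequality in each variable reduces the problem to a bilinear form in
    vectors of power sums modulo [2 ^ (q_j)], which by Parseval is controlled
    by the number of representations of such a vector. The latter is bounded by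
    Vinogradov's mean value theorem with [20 k ^ 2] variables on each side,
    which loses only one twentieth of the optimal exponent [k (k + 1) / 2].

    The mean value theorem is proved for [P = p ^ m] with a fixed prime [p] of
    size polynomial in [k]: either the exponential sum is dominated by one of
    its residue classes modulo [p], and one descends from [m] to [m - 1], or
    [k] different classes are large, and then Hensel's lemma shows that [k]
    power sums determine [k] variables in different classes. *)

Set Implicit Arguments.
Unset Strict Implicit.
Unset Printing Implicit Defensive.

Import Order.TTheory GRing.Theory Num.Theory.

Local Open Scope ring_scope.

(** * Power means and large coordinates *)

(** Chebyshev's sum inequality drives the induction: twice its defect is the double sum of [(a i - a
    j) * (a i ^+ n.+1 - a j ^+ n.+1)], whose terms are nonnegative. *)
Lemma power_mean (R : numDomainType) (I : finType) (a : I -> R) n :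
  (forall i, 0 <= a i) ->
  (\sum_i a i) ^+ n.+1 <= #|I|%:R ^+ n * \sum_i a i ^+ n.+1.
Proof.
move=> a0; elim: n => [|n IH]; first by rewrite expr1 expr0 mul1r.
have cheb : (\sum_i a i) * (\sum_i a i ^+ n.+1)
    <= #|I|%:R * \sum_i a i ^+ n.+2.
  rewrite -subr_ge0.
  have E : (#|I|%:R * (\sum_i a i ^+ n.+2)
            - (\sum_i a i) * (\sum_i a i ^+ n.+1)) *+ 2
        = \sum_i \sum_j (a i - a j) * (a i ^+ n.+1 - a j ^+ n.+1).
    have A : #|I|%:R * (\sum_i a i ^+ n.+2) = \sum_i \sum_(j : I) a i ^+ n.+2.
      under [RHS]eq_bigr do rewrite sumr_const cardT -cardE.
      by rewrite sumrMnl mulr_natl.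
    have B : (\sum_i a i) * (\sum_i a i ^+ n.+1)
           = \sum_i \sum_j a i * a j ^+ n.+1.
      by rewrite mulr_suml; apply: eq_bigr => i _; rewrite mulr_sumr.
    rewrite mulr2n A B.
    rewrite [X in _ + (X - _)]exchange_big [X in _ + (_ - X)]exchange_big.
    rewrite -!sumrB -big_split; apply: eq_bigr => i _.
    rewrite -!sumrB -big_split; apply: eq_bigr => j _ /=.
    by rewrite !(exprS _ n.+1); ring.
  rewrite -(pmulrn_lge0 _ (isT : 0 < 2)%N) E.
  apply: sumr_ge0 => i _; apply: sumr_ge0 => j _.
  case/orP: (ger_leVge (a0 i) (a0 j)) => le.
    by rewrite mulr_le0 // subr_le0 // lerXn2r // nnegrE.
  by rewrite mulr_ge0 // subr_ge0 // lerXn2r // nnegrE.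
rewrite exprS (le_trans (ler_wpM2l (sumr_ge0 _ _) IH)) //.
by rewrite mulrCA exprSr -mulrA ler_wpM2l // exprn_ge0.
Qed.

(* Either fewer than [k] of the [a i] exceed [F / 2n], and then the largest of
   them is at least [F / 2k], or [k] of them exceed [F / 2n]. *)
Lemma power_sum_dichotomy (R : numFieldType) n k b (a : 'I_n -> R) (F : R) :
  (0 < k)%N -> 0 <= F -> (forall i, 0 <= a i) -> F <= \sum_i a i ->
  F ^+ (2 * (b + k)) <= (2 * k)%:R ^+ (2 * (b + k)) * (\sum_i a i ^+ (2 * (b + k)))
    + (2 * n)%:R ^+ (2 * k) *
      (F ^+ (2 * b) *
       \sum_(f : {ffun 'I_k -> 'I_n} | injectiveb f) \prod_j a (f j) ^+ 2).
Proof.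
move=> k0 F0 a0 Fs.
set S1 := \sum_i _ ^+ _; set S2 := \sum_(f | _) _.
have S10 : 0 <= S1 by apply: sumr_ge0 => i _; rewrite exprn_ge0.
have S20 : 0 <= S2.
  by apply: sumr_ge0 => i _; apply: prodr_ge0 => j _; rewrite exprn_ge0.
pose I := [set i | F <= (2 * n)%:R * a i].
have [kI | Ik] := leqP k #|I|.
  pose f := [ffun j : 'I_k => enum_val (widen_ord kI j)].
  have finj : injectiveb f.
    apply/injectiveP => x y; rewrite !ffunE => /enum_val_inj /(congr1 val) /=.
    exact: val_inj.
  have fI j : F <= (2 * n)%:R * a (f j).
    by have := enum_valP (widen_ord kI j); rewrite inE ffunE.
  have le2 : F ^+ (2 * k) <= (2 * n)%:R ^+ (2 * k) * S2.
    rewrite /S2 (bigD1 f) //= mulrDr.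
    have -> : (2 * n)%:R ^+ (2 * k) * (\prod_j a (f j) ^+ 2)
            = \prod_(j < k) ((2 * n)%:R * a (f j)) ^+ 2.
      under [RHS]eq_bigr do rewrite exprMn.
      by rewrite [RHS]big_split /= prodr_const card_ord exprM.
    have -> : F ^+ (2 * k) = \prod_(j < k) F ^+ 2.
      by rewrite prodr_const card_ord exprM.
    apply: ler_wpDr.
      rewrite mulr_ge0 ?exprn_ge0 ?ler0n //; apply: sumr_ge0 => g _.
      by apply: prodr_ge0 => j _; rewrite exprn_ge0.
    apply: ler_prod => j _; rewrite exprn_ge0 //=.
    by rewrite lerXn2r ?nnegrE // mulr_ge0 ?ler0n.
  apply: ler_wpDl; first by rewrite mulr_ge0 ?exprn_ge0 ?ler0n.
  rewrite mulnDr exprD mulrCA ler_wpM2l // exprn_ge0 //.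
apply: ler_wpDr; first by rewrite !mulr_ge0 ?exprn_ge0 ?ler0n.
have [n0|n0] := posnP n.
  have F00 : F = 0.
    apply/eqP; rewrite eq_le F0 andbT (le_trans Fs) //.
    by move: (a) => a'; rewrite n0 in a' *; rewrite big_ord0.
  by rewrite F00 expr0n muln_eq0 addn_eq0 [k == 0%N]gtn_eqF // andbF /= mulr_ge0
    ?exprn_ge0 ?ler0n.
have lin (i : 'I_n) m : (0 < m)%N -> ~~ (F <= (2 * m)%:R * a i) -> a i <= F / (2 *
  m)%:R.
  move=> m0 h; rewrite ler_pdivlMr ?ltr0n ?muln_gt0 // mulrC.
  have := real_leVge (ger0_real F0) (ger0_real (mulr_ge0 (ler0n R (2 * m)) (a0 i))).
  by rewrite (negPf h).
have [/existsP[i Fi] | /existsPn none] :=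
    boolP [exists i, F <= (2 * k)%:R * a i].
  rewrite -[S1]/(\sum_i a i ^+ (2 * (b + k))) (bigD1 i) //= mulrDr -exprMn.
  apply: ler_wpDr; first by rewrite mulr_ge0 ?exprn_ge0 ?ler0n // sumr_ge0 // => j _;
    rewrite exprn_ge0.
  by rewrite lerXn2r // nnegrE // mulr_ge0 ?ler0n.
suff F00 : F <= 0.
  have -> : F = 0 by apply/eqP; rewrite eq_le F00.
  by rewrite expr0n muln_eq0 addn_eq0 [k == 0%N]gtn_eqF // andbF /= mulr_ge0
    ?exprn_ge0 ?ler0n.
(* Terms outside [I] are at most [F / 2n], all terms are at most [F / 2k], and [I] has fewer than
   [k] elements, so the total falls short of [F] by at least [F / 2k]. *)
have le : F <= F / 2 + #|I|%:R * (F / (2 * k)%:R).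
  apply: (le_trans Fs); rewrite (bigID (mem I)) /= addrC; apply: lerD.
    apply: (@le_trans _ _ (\sum_(i < n) F / (2 * n)%:R)).
      rewrite [leRHS](bigID (mem I)) /= addrC; apply: ler_wpDr.
        by apply: sumr_ge0 => i _; rewrite divr_ge0 ?ler0n.
      by apply: ler_sum => i; rewrite inE => /lin; apply.
    rewrite sumr_const card_ord -[leLHS]mulr_natl natrM invfM.
    by rewrite [leLHS](_ : _ = F / 2) //; field; rewrite pnatr_eq0 -lt0n.
  rewrite mulr_natl -sumr_const; apply: ler_sum => i _; exact: lin.
have le2 : #|I|%:R * (F / (2 * k)%:R) <= (k%:R - 1) * (F / (2 * k)%:R).
  rewrite ler_wpM2r ?divr_ge0 ?ler0n //.
  by rewrite -(@natrB _ k 1) // ler_nat subn1 -ltnS prednK.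
have E : F / 2 + (k%:R - 1) * (F / (2 * k)%:R) = F - F / (2 * k)%:R.
  by rewrite natrM; field; rewrite pnatr_eq0 -lt0n.
have : F <= F - F / (2 * k)%:R by rewrite -E; apply: (le_trans le); rewrite lerD2l.
by rewrite lerDl oppr_ge0 ler_pdivrMr ?ltr0n ?muln_gt0 // mul0r.
Qed.

(** * Additive characters of Z/W *)

(** Collisions of the vector-valued map [v]: the count that Parseval's identity extracts from a mean
    square of character sums. *)
Definition coll (X : finType) (V : eqType) k (v : X -> 'I_k -> V) : nat :=
  #|[set xy : X * X | [forall j, v xy.1 j == v xy.2 j]]|.

Section Characters.
Variables (C : numClosedFieldType) (W : nat) (om : C).
Hypotheses (W1 : (1 < W)%N) (om_prim : W.-primitive_root om).

Definition psi (x : 'Z_W) : C := om ^+ x.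

Lemma psiD x y : psi (x + y) = psi x * psi y.
Proof.
rewrite /psi -exprD -(prim_expr_mod om_prim) -[RHS](prim_expr_mod om_prim).
rewrite /=; move: (nat_of_ord x) (nat_of_ord y) => a b.
by rewrite Zp_cast // modn_mod.
Qed.

Lemma psi0 : psi 0 = 1. Proof. by rewrite /psi expr0. Qed.

Lemma psi_sum (I : Type) (r : seq I) (P : pred I) (F : I -> 'Z_W) :
  psi (\sum_(i <- r | P i) F i) = \prod_(i <- r | P i) psi (F i).
Proof. exact: (big_morph psi psiD psi0). Qed.

Lemma norm_psi x : `|psi x| = 1.
Proof.
apply/eqP; rewrite -(@pexpr_eq1 _ _ W) ?normr_ge0 ?(ltnW W1) //.
by rewrite -normrX /psi -exprM mulnC exprM (prim_expr_order om_prim) expr1n normr1.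
Qed.

Lemma psi_neq0 x : psi x != 0.
Proof. by rewrite -normr_eq0 norm_psi oner_eq0. Qed.

Lemma psiN x : psi (- x) = (psi x)^*.
Proof.
have : psi x * psi (- x) = psi x * (psi x)^*.
  by rewrite -normCK norm_psi expr1n -psiD subrr psi0.
by move/(mulfI (psi_neq0 x)).
Qed.

(** Translating [a] by 1 multiplies the sum by [psi d], which differs from 1 unless [d] is 0. *)
Lemma sum_psi d : \sum_a psi (a * d) = (W * (d == 0))%:R.
Proof.
have [->|d0] := eqVneq d 0.
  under eq_bigr do rewrite mulr0 psi0.
  by rewrite sumr_const card_ord Zp_cast // muln1.
rewrite muln0; set S := LHS.
have E : S = psi d * S.
  rewrite {1}/S (reindex_inj (addrI 1)) mulr_sumr; apply: eq_bigr => a _.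
  by rewrite mulrDl mul1r psiD.
have d1 : psi d != 1.
  rewrite /psi -(prim_order_dvd om_prim); apply: contra d0 => h.
  apply/eqP/val_inj => /=; move: h; have := ltn_ord d.
  rewrite [X in (_ < X)%N]Zp_cast // => lt h; apply/eqP; apply: contraTT h => h.
  by rewrite gtnNdvd ?lt0n.
have /eqP : (1 - psi d) * S = 0 by rewrite mulrBl mul1r -E subrr.
by rewrite mulf_eq0 subr_eq0 eq_sym (negPf d1) => /eqP.
Qed.

Lemma normsq_sum_psi (X : finType) (F : X -> 'Z_W) :
  `|\sum_x psi (F x)| ^+ 2 = \sum_(xy : X * X) psi (F xy.1 - F xy.2).
Proof.
have -> : `|\sum_x psi (F x)| ^+ 2 = (\sum_x psi (F x)) * (\sum_x psi (- F x)).
  rewrite normCK; congr (_ * _); rewrite rmorph_sum.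
  by apply: eq_bigr => x _; rewrite psiN.
rewrite mulr_suml -(pair_bigA _ (fun x y => psi (F x - F y))) /=.
by apply: eq_bigr => x _; rewrite mulr_sumr; apply: eq_bigr => y _; rewrite psiD.
Qed.

(** Expanding the square leaves, for each pair, a product over [j] of complete character sums, which
    vanishes unless the two vectors agree. *)
Lemma parseval (X : finType) k (v : X -> 'I_k -> 'Z_W) :
  \sum_(al : {ffun 'I_k -> 'Z_W}) `|\sum_x psi (\sum_j al j * v x j)| ^+ 2
    = (W ^ k * coll v)%:R.
Proof.
under eq_bigr => al _.
  rewrite normsq_sum_psi.
  under eq_bigr => xy _.
    rewrite -sumrB; under eq_bigr do rewrite -mulrBr.
    rewrite psi_sum; over.
  over.
rewrite exchange_big /= /coll natrM -sum1_card natr_sum [X in _ * X]big_mkcond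
  mulr_sumr /=.
apply: eq_bigr => xy _.
rewrite -(bigA_distr_bigA (fun j a => psi (a * (v xy.1 j - v xy.2 j)))).
under eq_bigr do rewrite sum_psi natrM subr_eq0.
rewrite big_split /= prodr_const card_ord -natrX inE.
case: forallP => [h|/forallP].
  by rewrite big1 // => j _; rewrite h.
rewrite negb_forall => /existsP[j /negPf jn].
by rewrite (bigD1 j) //= jn mul0r mulr0 // .
Qed.
End Characters.

(** * Counting lemmas and power sums modulo p^e *)

Lemma card_le_fibers (T Y : finType) (A : {set T}) (G : {set Y}) (f : T -> Y) M :
  (forall a, a \in A -> f a \in G) ->
  (forall y, (#|[set a in A | f a == y]| <= M)%N) -> (#|A| <= #|G| * M)%N.
Proof.
move=> AG fM; rewrite -sum1_card (partition_big f (mem G)) //=.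
rewrite -sum_nat_const; apply: leq_sum => y _.
by apply: leq_trans (fM y); rewrite sum1_card [leqLHS]cardE [leqRHS]cardE;
  apply: eq_leq; congr size; apply: eq_enum => a; rewrite inE.
Qed.

Lemma card_le_residues (T : finType) (A : {set T}) k (n : 'I_k -> nat)
    (F : T -> 'I_k -> int) :
  (forall l, (0 < n l)%N) ->
  (forall x y, x \in A -> y \in A ->
     (forall l, (n l %| F x l - F y l)%Z) -> x = y) ->
  (#|A| <= \prod_l n l)%N.
Proof.
move=> n0 inj.
have lt l z : (`|(z %% (n l)%:Z)%Z|%N < n l)%N.
  have nz : (n l)%:Z != 0 by have := n0 l; case: (n l).
  by rewrite -ltz_nat gez0_abs ?modz_ge0 // ltz_pmod // ltz_nat.
pose f x : {dffun forall l, 'I_(n l)} := [ffun l => Ordinal (lt l (F x l))].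
have finj : {in A &, injective f}.
  move=> x y xA yA /ffunP E; apply: inj => // l.
  have := E l; rewrite !ffunE => /(congr1 val) /= El.
  have nz : (n l)%:Z != 0 by have := n0 l; case: (n l).
  rewrite -eqz_mod_dvd; apply/eqP.
  by rewrite -[LHS]gez0_abs ?modz_ge0 // El gez0_abs ?modz_ge0.
rewrite -(card_in_imset finj) (leq_trans (max_card _)) //.
rewrite card_dep_ffun.
rewrite foldrE big_map big_enum /=.
by apply: eq_leq; apply: eq_bigr => l _; rewrite card_ord.
Qed.

(** Grouped by the common value, this is [2 N M <= N ^ 2 + M ^ 2] for the fibre sizes [N] of [v] and
    [M] of [w]. *)
Lemma card_matches (X : finType) (V : eqType) (v w : X -> V) :
  (2 * #|[set xy : X * X | v xy.1 == w xy.2]| <=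
    #|[set xy : X * X | v xy.1 == v xy.2]| + #|[set xy : X * X | w xy.1 == w xy.2]|)%N.
Proof.
pose S := undup (codom v ++ codom w).
pose N (f : X -> V) u := (\sum_x (f x == u))%N.
have E (f g : X -> V) : (forall x, f x \in S) ->
   #|[set xy : X * X | f xy.1 == g xy.2]| = (\sum_(u <- S) N f u * N g u)%N.
  move=> fS; rewrite -sum1_card big_mkcond /=.
  transitivity (\sum_(xy : X * X) \sum_(u <- S) (f xy.1 == u) * (g xy.2 == u))%N.
    apply: eq_bigr => -[x y] _ /=; rewrite inE /=.
    rewrite (bigD1_seq (f x)) ?undup_uniq //= eqxx mul1n eq_sym.
    rewrite big1 ?addn0; first by case: eqP.
    by move=> u; rewrite eq_sym => /negPf ->.
  rewrite exchange_big /=; apply: eq_bigr => u _.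
  rewrite /N big_distrl -(pair_bigA _ (fun x y => (f x == u) * (g y == u))%N) /=.
  by apply: eq_bigr => x _; rewrite big_distrr.
have vS x : v x \in S by rewrite mem_undup mem_cat codom_f.
have wS x : w x \in S by rewrite mem_undup mem_cat codom_f orbT.
rewrite !E // -big_split big_distrr /=; apply: leq_sum => u _.
exact: (nat_Cauchy (N v u) (N w u)).1.
Qed.

(** [v] and its translate by [D] have equally many collisions, so [card_matches] bounds the
    inhomogeneous system by the homogeneous one. *)
Lemma card_shifted_matches (X : finType) k (v : X -> 'I_k -> int) (D : 'I_k -> int) :
  (#|[set xy : X * X | [forall j, v xy.1 j == (v xy.2 j + D j)%R]]| <= coll v)%N.
Proof.
pose f (x : X) := [ffun j => v x j].
pose g (x : X) := [ffun j => v x j + D j].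
have Ef : coll v = #|[set xy : X * X | f xy.1 == f xy.2]|.
  apply: eq_card => -[x y]; rewrite !inE /=.
  apply/forallP/eqP => [h|/ffunP h j]; first by apply/ffunP=> j; rewrite !ffunE;
    apply/eqP.
  by have := h j; rewrite !ffunE => ->.
have Eg : coll v = #|[set xy : X * X | g xy.1 == g xy.2]|.
  apply: eq_card => -[x y]; rewrite !inE /=.
  apply/forallP/eqP => [h|/ffunP h j].
    by apply/ffunP=> j; rewrite !ffunE (eqP (h j)).
  by have := h j; rewrite !ffunE => /addIr ->.
have -> : #|[set xy : X * X | [forall j, v xy.1 j == (v xy.2 j + D j)%R]]| = #|[set
  xy : X * X | f xy.1 == g xy.2]|.
  apply: eq_card => -[x y]; rewrite !inE /=.
  apply/forallP/eqP => [h|/ffunP h j]; first by apply/ffunP=> j; rewrite !ffunE;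
    apply/eqP.
  by have := h j; rewrite !ffunE => ->.
have := card_matches f g; rewrite -Ef -Eg; lia.
Qed.

Lemma coll_le (X : finType) (V V' : eqType) k (v : X -> 'I_k -> V) (v' : X -> 'I_k ->
  V') :
  (forall x y, (forall j, v x j = v y j) -> forall j, v' x j = v' y j) ->
  (coll v <= coll v')%N.
Proof.
move=> h; apply/subset_leq_card/subsetP => -[x y]; rewrite !inE /= => /forallP E.
by apply/forallP => j; apply/eqP; apply: h => i; apply/eqP.
Qed.

Lemma horner_sum_eq (A : comNzRingType) k (I : finType) (x y : I -> A) (h : {poly A}) :
  (forall j : 'I_k, \sum_i x i ^+ j.+1 = \sum_i y i ^+ j.+1) ->
  (size h <= k.+1)%N -> \sum_i h.[x i] = \sum_i h.[y i].
Proof.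
move=> E sh.
have H (z : I -> A) : \sum_i h.[z i] = \sum_(j < k.+1) h`_j * \sum_i z i ^+ j.
  under eq_bigr do rewrite (horner_coef_wide _ sh).
  by rewrite exchange_big; apply: eq_bigr => j _; rewrite mulr_sumr.
rewrite !H; apply: eq_bigr => -[[|j] lt] _ /=.
  by congr (_ * _); apply: eq_bigr.
by rewrite (E (Ordinal (lt : (j < k)%N))).
Qed.

Lemma expr_taylor2 (A : comNzRingType) (x d : A) n :
  exists c, (x + d) ^+ n.+1 = x ^+ n.+1 + n.+1%:R * x ^+ n * d + d ^+ 2 * c.
Proof.
elim: n => [|n [c IH]]; first by exists 0; rewrite !expr1 expr0; ring.
exists (n.+1%:R * x ^+ n + c * (x + d)).
rewrite exprS IH !(exprS x n.+1) !(exprS x n) [n.+2%:R]mulrSr; ring.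
Qed.

(** The polynomial with roots [x i], [i != j0], has degree below [k]; combining the relations with
    its coefficients isolates [z j0]. *)
Lemma dual_vandermonde (F : fieldType) k (x z : 'I_k -> F) :
  injective x -> (forall l : 'I_k, \sum_j x j ^+ l * z j = 0) -> forall j, z j = 0.
Proof.
move=> xinj E j0.
pose h := \prod_(i < k | i != j0) ('X - (x i)%:P).
have sh : (size h <= k)%N.
  rewrite /h -big_filter size_prod_XsubC -sum1_size big_filter sum1_card.
  by rewrite (cardC1 j0) card_ord prednK // (leq_trans _ (ltn_ord j0)).
have : \sum_j h.[x j] * z j = 0.
  transitivity (\sum_(l < k) h`_l * \sum_j x j ^+ l * z j).
    under eq_bigr do rewrite (horner_coef_wide _ sh) mulr_suml.
    rewrite exchange_big; apply: eq_bigr => l _; rewrite mulr_sumr.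
    by apply: eq_bigr => j _; rewrite mulrA.
  by rewrite big1 // => l _; rewrite E mulr0.
rewrite (bigD1 j0) //= [X in _ + X]big1 ?addr0 => [|i ij].
  move/eqP; rewrite mulf_eq0 => /orP[|/eqP //].
  rewrite horner_prod prodf_seq_eq0 => /hasP[i _ /andP[ij]].
  by rewrite hornerXsubC subr_eq0 => /eqP /xinj ji; rewrite ji eqxx in ij.
by rewrite horner_prod (bigD1 i) //= hornerXsubC subrr !mul0r.
Qed.

(** For [y = x + p ^ e z] the power sums of exponent [l + 1] differ by
    [p ^ e (l + 1) \sum_j x j ^ l * z j] modulo [p ^ (2 e)]. As [l + 1] is a unit modulo [p] and the
    [x j] are distinct modulo [p], the Vandermonde system forces [z = 0] modulo [p]. *)
Lemma hensel_power_sums p k e (x y : 'I_k -> int) :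
  prime p -> (k < p)%N ->
  (forall i j, (p %| x i - x j)%Z -> i = j) ->
  (forall j, (p %| x j - y j)%Z) ->
  (forall l : 'I_k, ((p ^ e)%N %| \sum_j x j ^+ l.+1 - \sum_j y j ^+ l.+1)%Z) ->
  forall j, ((p ^ e)%N %| x j - y j)%Z.
Proof.
move=> pp kp xd xy; have pF := pchar_Fp pp.
elim: e => [|e IH] E; first by move=> j; rewrite expn0 dvd1z.
(* The remainder modulo [p ^ (2 e)] is harmless only for [e > 0]; the first step is the given
   congruence modulo [p]. *)
have [->|e0] := posnP e; first by move=> j; rewrite expn1.
have dv : ((p ^ e)%N %| (p ^ e.+1)%N%:Z)%Z by rewrite dvdzE /= dvdn_exp2l.
pose z j := ((y j - x j) %/ (p ^ e)%N)%Z.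
have yE j : y j = x j + (p ^ e)%N%:Z * z j.
  rewrite mulrC divzK; first by ring.
  by rewrite -rpredN opprB; apply: IH => l; exact: dvdz_trans dv (E l).
have z0 : forall j, ((z j)%:~R : 'F_p) = 0.
  apply: (dual_vandermonde (x := fun j => (x j)%:~R)) => [i j /eqP|l].
    by rewrite -subr_eq0 -rmorphB /= -(dvdz_pcharf pF) => /xd.
  have l0 : (l.+1%:R : 'F_p) != 0.
    by rewrite -(dvdn_pcharf pF) gtnNdvd // (leq_ltn_trans _ kp).
  apply: (mulfI l0); rewrite mulr0.
  have -> : (l.+1%:R : 'F_p) * (\sum_j (x j)%:~R ^+ l * (z j)%:~R)
     = (l.+1%:R * \sum_j x j ^+ l * z j)%:~R.
    rewrite rmorphM /= rmorph_nat rmorph_sum; congr (_ * _).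
    by apply: eq_bigr => j _; rewrite rmorphM rmorphXn.
  apply/eqP; rewrite -(dvdz_pcharf pF).
  have pe0 : (p ^ e)%N%:Z != 0 by rewrite -lt0n expn_gt0 prime_gt0.
  rewrite -(dvdz_mul2l pe0) -PoszM -expnSr.
  have c j : {c : int | y j ^+ l.+1 == x j ^+ l.+1 + l.+1%:R * x j ^+ l * ((p ^
    e)%N%:Z * z j)
               + ((p ^ e)%N%:Z * z j) ^+ 2 * c}.
    by apply: sigW; rewrite yE; have [c ->] := expr_taylor2 (x j) ((p ^ e)%N%:Z * z
      j) l; exists c.
  have := E l; rewrite -rpredN opprB -sumrB.
  have -> : \sum_j (y j ^+ l.+1 - x j ^+ l.+1) =
     (p ^ e)%N%:Z * (l.+1%:R * \sum_j x j ^+ l * z j) + (p ^ e)%N%:Z ^+ 2 * \sum_j z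
       j ^+ 2 * sval (c j).
    rewrite !mulr_sumr -big_split /=; apply: eq_bigr => j _.
    by case: (c j) => c' /= /eqP ->; ring.
  have dv2 : ((p ^ e.+1)%N %| (p ^ e)%N%:Z ^+ 2)%Z.
    by rewrite expr2 -PoszM mulnn dvdzE /= -expnM dvdn_exp2l //; lia.
  by rewrite rpredDr // dvdz_mulr.
move=> j; rewrite -rpredN opprB [X in (_ %| X)%Z](_ : _ = (p ^ e)%N%:Z * z j);
  last by rewrite yE; ring.
by rewrite expnSr PoszM dvdz_mul // (dvdz_pcharf pF) z0.
Qed.

(** * Solutions counted modulo a power of p *)

(* Here and below the index [j : 'I_k] stands for the exponent [j + 1]. *)
Definition power_sums k (I : finType) (x : I -> nat) (j : 'I_k) : nat :=
  (\sum_i x i ^ j.+1)%N.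

(* [J_{b,k}(n)] in the usual notation, with variables in [0, n - 1]. *)
Definition vinogradov k b n : nat :=
  coll (fun x : {ffun 'I_b -> 'I_n} => power_sums (k := k) (fun i => x i : nat)).

Lemma power_sums_int k (I : finType) (x : I -> nat) (j : 'I_k) :
  (power_sums x j)%:Z = \sum_i (x i)%:Z ^+ j.+1.
Proof.
by rewrite /power_sums -natz natr_sum; apply: eq_bigr => i _; rewrite natrX natz.
Qed.

(** [(X - r) ^ (j + 1)] has degree at most [k], so its sum over the variables depends only on their
    power sums and their number. *)
Lemma power_sums_translate k (I : finType) (x y : I -> nat) (r : int) :
  (forall j : 'I_k, power_sums x j = power_sums y j) ->
  forall j : 'I_k, \sum_i ((x i)%:Z - r) ^+ j.+1 = \sum_i ((y i)%:Z - r) ^+ j.+1.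
Proof.
move=> E j.
have H (z : I -> nat) : \sum_i ((z i)%:Z - r) ^+ j.+1 = \sum_i (('X - r%:P) ^+
  j.+1).[(z i)%:Z].
  by apply: eq_bigr => i _; rewrite horner_exp hornerXsubC.
rewrite !H.
apply: (horner_sum_eq (k := k) (x := fun i => (x i)%:Z) (y := fun i => (y i)%:Z)).
  by move=> i; rewrite -!power_sums_int E.
by rewrite size_exp_XsubC !ltnS.
Qed.

(** Vinogradov's system is invariant under translation and dilation. *)
Lemma coll_affine k b n r q : (0 < q)%N ->
  (coll (fun x : {ffun 'I_b -> 'I_n} => power_sums (k := k) (fun i => r + q * x i)) <=
    vinogradov k b n)%N.
Proof.
move=> q0; apply: coll_le => x y E j.
have := power_sums_translate r%:Z E j.
have H (z : {ffun 'I_b -> 'I_n}) : \sum_i ((r + q * z i)%N%:Z - r%:Z) ^+ j.+1 = q%:Z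
  ^+ j.+1 * (power_sums (fun i => z i : nat) j)%:Z.
  rewrite power_sums_int mulr_sumr; apply: eq_bigr => i _.
  by rewrite PoszD PoszM [X in X ^+ _](_ : _ = q%:Z * (z i)%:Z) ?exprMn //; ring.
rewrite !H => /mulfI F; apply/eqP; rewrite -eqz_nat; apply/eqP/F.
by rewrite expf_neq0 // -lt0n.
Qed.

Section Congruences.
Variables (p k m u b r : nat) (f : {ffun 'I_k -> 'I_p}).
Hypotheses (pp : prime p) (kp : (k < p)%N) (m0 : (0 < m)%N) (um : (m <= u * k)%N).
Hypothesis finj : injective f.
Let X (x : {ffun 'I_k -> 'I_(p ^ m.-1)}) i : nat := (f i + p * x i)%N.
Let q := (p ^ u)%N.

Let pw x (j : 'I_k) : int := \sum_i ((X x i)%:Z - r%:Z) ^+ j.+1.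

Let q0 : (0 < q)%N. Proof. by rewrite expn_gt0 prime_gt0. Qed.

(** Each [pw x j - pw x' j] is [q ^ (j + 1)] times a quotient. The quotients modulo
    [q ^ (k - j - 1)], with [q ^ 'C(k, 2)] choices in all, fix the power sums modulo
    [q ^ k = p ^ (u k)]; by Hensel they fix [x], since the variables lie in distinct classes and
    below [p ^ m]. *)
Lemma card_congruent_tuples x' :
  (#|[set x | [forall j : 'I_k, ((q ^ j.+1)%N %| (pw x j - pw x' j)%R)%Z]]| <= q ^
    'C(k, 2))%N.
Proof.
pose A := [set x | [forall j : 'I_k, ((q ^ j.+1)%N %| pw x j - pw x' j)%Z]].
have := @card_le_residues _ A k (fun j : 'I_k => (q ^ (k - j.+1))%N)
  (fun x j => ((pw x j - pw x' j) %/ (q ^ j.+1)%N)%Z).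
have -> : (\prod_(j < k) q ^ (k - j.+1) = q ^ 'C(k, 2))%N.
  rewrite -expn_sum -triangular_sum (reindex_inj rev_ord_inj) big_mkord;
    congr (_ ^ _)%N.
  by apply: eq_bigr => j _ /=; rewrite subnSK // subKn // ltnW.
apply=> [j|x y]; first by rewrite expn_gt0 q0.
rewrite !inE => /forallP xA /forallP yA E.
have dv (j : 'I_k) : ((p ^ (u * k))%N %| pw x j - pw y j)%Z.
  have [/divzK xE /divzK yE] := (xA j, yA j).
  have -> : pw x j - pw y j = (pw x j - pw x' j) - (pw y j - pw x' j) by ring.
  rewrite -xE -yE -mulrBl expnM -/q.
  have -> : (q ^ k = q ^ (k - j.+1) * q ^ j.+1)%N by rewrite -expnD subnK.
  by rewrite PoszM dvdz_mul.
have Xd z t i j : (X z i)%:Z - r%:Z - ((X t j)%:Z - r%:Z)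
    = p%:Z * ((z i)%:Z - (t j)%:Z) + ((f i)%:Z - (f j)%:Z).
  by rewrite /X !PoszD !PoszM; ring.
have H i : ((p ^ (u * k))%N %| ((X x i)%:Z - r%:Z) - ((X y i)%:Z - r%:Z))%Z.
  move: i; apply: hensel_power_sums pp kp _ _ dv => [i j|i].
    rewrite Xd rpredDl ?dvdz_mulr // => h; apply: finj.
    apply/val_inj/eqP; rewrite -eqz_nat; move: h; rewrite -eqz_mod_dvd.
    by rewrite !modz_small // /= ltz_nat ltn_ord.
  by rewrite Xd subrr addr0 dvdz_mulr.
apply/ffunP => i; apply/val_inj/eqP => /=; rewrite -eqz_nat -subr_eq0.
apply: contraTT (H i) => ne; rewrite Xd subrr addr0 dvdzE /= abszM.
rewrite gtnNdvd ?muln_gt0 ?absz_gt0 ?ne ?andbT ?absz_nat ?prime_gt0 -?lt0n ?prime_gt0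
  //.
apply: (@leq_trans (p ^ m)%N); last by rewrite leq_exp2l ?prime_gt1.
have -> : (p ^ m = p * p ^ m.-1)%N by rewrite -expnS prednK.
rewrite ltn_pmul2l ?prime_gt0 //.
have aux (c d n : nat) : (c < n)%N -> (d < n)%N -> (`|c%:Z - d%:Z| < n)%N by lia.
exact: aux (ltn_ord _) (ltn_ord _).
Qed.

(** After translation by [r] the second block of variables consists of multiples of [q], so the
    [j]-th equation makes the [pw] of the first blocks congruent modulo [q ^ (j + 1)]. Once the
    first blocks are fixed, the second ones solve a shifted Vinogradov system. *)
Lemma coll_congruent_le :
  (coll (fun (xz : {ffun 'I_k -> 'I_(p ^ m.-1)} * {ffun 'I_b -> 'I_(p ^ (m - u))}) (j
    : 'I_k) =>
     (power_sums (X xz.1) j + power_sums (fun i => r + q * xz.2 i) j)%N)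
   <= (p ^ m.-1) ^ k * q ^ 'C(k, 2) * vinogradov k b (p ^ (m - u)))%N.
Proof.
pose good := [set xx : {ffun 'I_k -> 'I_(p ^ m.-1)} * {ffun 'I_k -> 'I_(p ^ m.-1)} |
  [forall j : 'I_k, ((q ^ j.+1)%N %| pw xx.1 j - pw xx.2 j)%Z]].
pose zw (z : {ffun 'I_b -> 'I_(p ^ (m - u))}) (j : 'I_k) : int :=
  (power_sums (fun i => z i : nat) j)%:Z.
have key (xz xz' : {ffun 'I_k -> 'I_(p ^ m.-1)} * {ffun 'I_b -> 'I_(p ^ (m - u))}) :
    (forall j : 'I_k, (power_sums (X xz.1) j + power_sums (fun i => r + q * xz.2 i) j
    = power_sums (X xz'.1) j + power_sums (fun i => r + q * xz'.2 i) j)%N) ->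
    forall j, pw xz.1 j - pw xz'.1 j = (zw xz'.2 j - zw xz.2 j) * (q ^ j.+1)%N%:Z.
  move=> E j.
  (* Both blocks form one family over a disjoint union, to which translation invariance applies. *)
  pose Y (xz : {ffun 'I_k -> 'I_(p ^ m.-1)} * {ffun 'I_b -> 'I_(p ^ (m - u))}) (s :
    'I_k + 'I_b) :=
    match s with inl i => X xz.1 i | inr i => (r + q * xz.2 i)%N end.
  have EY (i : 'I_k) : power_sums (Y xz) i = power_sums (Y xz') i.
    by rewrite /power_sums !big_sumType; exact: E.
  have := power_sums_translate r%:Z EY j.
  have HY z : \sum_s ((Y z s)%:Z - r%:Z) ^+ j.+1 = pw z.1 j + (q ^ j.+1)%N%:Z * zw
    z.2 j.
    rewrite big_sumType; congr (_ + _); rewrite /zw power_sums_int mulr_sumr;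
      apply: eq_bigr => i _.
    rewrite /= PoszD PoszM [X in X ^+ _](_ : _ = q%:Z * (z.2 i)%:Z); last by ring.
    by rewrite exprMn -!natz natrX.
  rewrite !HY => H.
  have -> : pw xz.1 j = (pw xz.1 j + (q ^ j.+1)%N%:Z * zw xz.2 j) - (q ^ j.+1)%N%:Z *
    zw xz.2 j by ring.
  by rewrite H; ring.
have cgood : (#|good| <= (p ^ m.-1) ^ k * q ^ 'C(k, 2))%N.
  have := @card_le_fibers _ _ good setT (fun xx => xx.2) (q ^ 'C(k, 2)).
  rewrite cardsT card_ffun !card_ord; apply=> // x'.
  apply: leq_trans (card_congruent_tuples x').
  rewrite -(card_in_imset (f := fun xx : _ * _ => xx.1)); last first.
    move=> [x1 y1] [x2 y2]; rewrite !inE /= => /andP[_ /eqP ->] /andP[_ /eqP ->].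
    by move=> ->.
  apply/subset_leq_card/subsetP => x /imsetP[[y1 y2]]; rewrite !inE /=.
  by move=> /andP[h /eqP <-] ->.
apply: leq_trans (leq_mul cgood (leqnn _)).
apply: (card_le_fibers (f := fun xx : _ * _ => (xx.1.1, xx.2.1))) => [[xz xz']|[x x']].
  rewrite !inE /= => /forallP E; apply/forallP => j.
  by rewrite key ?dvdz_mull // => i; apply/eqP.
pose D (j : 'I_k) : int := (- ((pw x j - pw x' j) %/ (q ^ j.+1)%N%:Z)%Z).
apply: leq_trans (_ : coll zw <= _)%N; last first.
  by apply: coll_le => z z' E j; apply/eqP; rewrite -eqz_nat; apply/eqP/E.
apply: leq_trans (card_shifted_matches zw D).
rewrite -(card_in_imset (f := fun xx : _ * _ => (xx.1.2, xx.2.2))); last first.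
  move=> [[x1 z1] [x2 z2]] [[y1 t1] [y2 t2]]; rewrite !inE /=.
  by move=> /andP[_ /eqP[-> ->]] /andP[_ /eqP[-> ->]] [-> ->].
apply/subset_leq_card/subsetP => zz /imsetP[[[x1 z1] [x2 z2]]]; rewrite !inE /=.
move=> /andP[/forallP E /eqP[ex ex2]] -> /=; apply/forallP => j; apply/eqP.
rewrite /D -ex -ex2 (key (x1, z1) (x2, z2)) /=; last by move=> i; apply/eqP.
rewrite mulzK; first by ring.
by rewrite -lt0n expn_gt0 q0.
Qed.
End Congruences.

(** * Recursion for Vinogradov's mean value *)

Lemma big_digits (V : nmodType) a c (G : nat -> V) :
  \sum_(x < a * c) G x = \sum_(i < a) \sum_(y < c) G (i + a * y)%N.
Proof.
rewrite exchange_big /=; elim: c => [|c IH]; first by rewrite muln0 !big_ord0.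
rewrite big_ord_recr /= -IH mulnS addnC big_split_ord /=; congr (_ + _).
by apply: eq_bigr => i _; rewrite addnC.
Qed.

Section Moments.
Variables (C : numClosedFieldType) (W : nat) (om : C).
Hypotheses (W1 : (1 < W)%N) (om_prim : W.-primitive_root om).

Definition chr k (al : {ffun 'I_k -> 'Z_W}) (v : 'I_k -> nat) : C :=
  psi om (\sum_j al j * (v j)%:R).

Lemma chrD k (al : {ffun 'I_k -> 'Z_W}) u v :
  chr al (fun j => u j + v j)%N = chr al u * chr al v.
Proof.
rewrite /chr -psiD // -big_split; congr psi; apply: eq_bigr => j _.
by rewrite natrD mulrDr.
Qed.

Lemma chr_sum k (al : {ffun 'I_k -> 'Z_W}) (I : finType) (v : I -> 'I_k -> nat) :
  chr al (fun j => \sum_i v i j)%N = \prod_i chr al (v i).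
Proof.
rewrite /chr -psi_sum // exchange_big; congr psi; apply: eq_bigr => j _.
by rewrite natr_sum mulr_sumr.
Qed.

Lemma prod_sum_chr k (al : {ffun 'I_k -> 'Z_W}) b n (v : 'I_b -> nat -> 'I_k -> nat) :
  \prod_i \sum_(x < n) chr al (v i x) =
  \sum_(f : {ffun 'I_b -> 'I_n}) chr al (fun j => \sum_i v i (f i) j)%N.
Proof.
rewrite (bigA_distr_bigA (fun i (x : 'I_n) => chr al (v i x))) /=.
by apply: eq_bigr => f _; rewrite chr_sum.
Qed.

(** Values below [W] make congruence modulo [W] the same as equality, so the finite identity counts
    integer solutions. *)
Lemma parseval_nat (X : finType) k (v : X -> 'I_k -> nat) :
  (forall x j, (v x j < W)%N) ->
  \sum_(al : {ffun 'I_k -> 'Z_W}) `|\sum_x chr al (v x)| ^+ 2 = (W ^ k * coll v)%:R.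
Proof.
move=> vW; rewrite /chr (parseval W1 om_prim (fun x j => (v x j)%:R)).
congr (_ * _)%:R; apply/eqP; rewrite eqn_leq; apply/andP; split.
  apply: coll_le => x y E j; have /(congr1 (@nat_of_ord _)) := E j.
  by rewrite !val_Zp_nat // !modn_small.
by apply: coll_le => x y E j; rewrite E.
Qed.
End Moments.

Lemma power_sums_lt k n M (I : finType) (x : I -> nat) (j : 'I_k) :
  (forall i, x i < n)%N -> (#|I| * n ^ k < M)%N -> (power_sums x j < M)%N.
Proof.
move=> xn; apply: leq_ltn_trans.
rewrite -sum_nat_const; apply: leq_sum => i _.
have n0 : (0 < n)%N by apply: leq_ltn_trans (xn i).
apply: leq_trans (_ : n ^ j.+1 <= _)%N; first by rewrite leq_exp2r // ltnW.
by rewrite leq_pexp2l.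
Qed.

Section Recursion.
Variables (p k b m u : nat).
Hypotheses (pp : prime p) (kp : (k < p)%N) (k0 : (0 < k)%N) (b0 : (0 < b)%N)
  (m0 : (0 < m)%N) (um : (m <= u * k)%N) (um' : (u <= m)%N).
Let q := (p ^ u)%N.
Let n1 := (p ^ m.-1)%N.
Let n2 := (p ^ (m - u))%N.
Let W := ((b + k) * (p ^ m) ^ k).+2.
Let W1 : (1 < W)%N. Proof. by []. Qed.

(** The sum [f] is split into its classes [g] modulo [p] and [h] modulo [q], and the dichotomy is
    applied to the [|g i|]. Averaging over all frequencies modulo [W], which exceeds every power sum
    involved, turns the moments into solution counts. *)
Lemma vinogradov_recursion :
  (vinogradov k (b + k) (p ^ m) <=
    (2 * k) ^ (2 * (b + k)) * (p * vinogradov k (b + k) n1)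
    + (2 * p) ^ (2 * k) * (p ^ k * (q ^ (2 * b) *
        (n1 ^ k * q ^ 'C(k, 2) * vinogradov k b n2))))%N.
Proof.
have [om om_prim] := C_prim_root_exists (ltnW W1).
pose pv (y : nat) (j : 'I_k) : nat := (y ^ j.+1)%N.
pose f (al : {ffun 'I_k -> 'Z_W}) : algC := \sum_(x < p ^ m) chr om al (pv x).
pose g (al : {ffun 'I_k -> 'Z_W}) (i : 'I_p) : algC := \sum_(x < n1) chr om al (pv (i
  + p * x)%N).
pose h (al : {ffun 'I_k -> 'Z_W}) (r : 'I_q) : algC := \sum_(x < n2) chr om al (pv (r
  + q * x)%N).
have pE : (p ^ m = p * n1)%N by rewrite -expnS prednK.
have qE : (p ^ m = q * n2)%N by rewrite -expnD subnKC.
have fg al : f al = \sum_i g al i.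
  by rewrite /f pE (big_digits _ _ (fun x => chr om al (pv x))).
have fh al : f al = \sum_r h al r.
  by rewrite /f qE (big_digits _ _ (fun x => chr om al (pv x))).
have Wbig n : (n <= b + k)%N -> (n * (p ^ m) ^ k < W)%N.
  by move=> nb; rewrite ltnS leqW // leq_mul2r nb orbT.
have dig a c (i : 'I_a) (x : 'I_c) : (p ^ m = a * c)%N -> (i + a * x < p ^ m)%N.
  by move=> ->; have := ltn_ord i; have := ltn_ord x; nia.
have mom1 : \sum_al `|f al| ^+ (2 * (b + k)) = (W ^ k * vinogradov k (b + k) (p ^
  m))%:R.
  rewrite -(parseval_nat W1 om_prim).
    apply: eq_bigr => al _; rewrite mulnC exprM -normrX; congr (`|_| ^+ _).
    rewrite -[in LHS](card_ord (b + k)) -prodr_const.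
    exact: (prod_sum_chr W1 om_prim al (p ^ m) (fun _ => pv)).
  move=> x j; apply: (power_sums_lt (n := (p ^ m)%N)); first by move=> i;
    exact: ltn_ord.
  by rewrite card_ord Wbig.
have mom2 i : \sum_al `|g al i| ^+ (2 * (b + k)) <= (W ^ k * vinogradov k (b + k)
  n1)%:R.
  have E : \sum_al `|g al i| ^+ (2 * (b + k)) = (W ^ k * coll (fun x : {ffun 'I_(b +
    k) -> 'I_n1} => power_sums (k := k) (fun s => i + p * x s)%N))%:R.
    rewrite -(parseval_nat W1 om_prim).
      apply: eq_bigr => al _; rewrite mulnC exprM -normrX; congr (`|_| ^+ _).
      rewrite -[in LHS](card_ord (b + k)) -prodr_const.
      exact: (prod_sum_chr W1 om_prim al n1 (fun _ x => pv (i + p * x)%N)).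
    move=> x j; apply: (power_sums_lt (n := (p ^ m)%N)); first by move=> s; apply: dig.
    by rewrite card_ord Wbig.
  rewrite E ler_nat leq_mul2l; apply/orP; right.
  by apply: coll_affine; rewrite prime_gt0.
(* The mixed moment counts collisions with [k] variables in the distinct classes [t j] modulo [p]
   and [b] variables in one class [r] modulo [q]. *)
have mom3 (t : {ffun 'I_k -> 'I_p}) r : injective t ->
    \sum_al (`|h al r| ^+ (2 * b) * \prod_j `|g al (t j)| ^+ 2)
    <= (W ^ k * (n1 ^ k * q ^ 'C(k, 2) * vinogradov k b n2))%:R.
  move=> tinj.
  pose v (xz : {ffun 'I_k -> 'I_n1} * {ffun 'I_b -> 'I_n2}) (j : 'I_k) :=
     (power_sums (fun i => t i + p * xz.1 i) j + power_sums (fun i => r + q * xz.2 i)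
       j)%N.
  have E : \sum_al (`|h al r| ^+ (2 * b) * \prod_j `|g al (t j)| ^+ 2) = (W ^ k *
    coll v)%:R.
    rewrite -(parseval_nat W1 om_prim).
      apply: eq_bigr => al _.
      rewrite exprM exprAC -normrX prodrXl -normr_prod -exprMn -normrM mulrC;
        congr (`|_| ^+ _).
      rewrite -[X in _ ^+ X](card_ord b) -prodr_const.
      rewrite (prod_sum_chr W1 om_prim al n1 (fun i x => pv (t i + p * x)%N)).
      rewrite (prod_sum_chr W1 om_prim al n2 (fun _ x => pv (r + q * x)%N)).
      rewrite mulr_suml -(pair_bigA _ (fun x z => chr om al (v (x, z)))) /=.
      by apply: eq_bigr => x _; rewrite mulr_sumr; apply: eq_bigr => z _; rewrite -chrD.
    move=> [x z] j; rewrite /v /=.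
    have L1 : (power_sums (fun i => t i + p * x i) j < (k * (p ^ m) ^ k).+1)%N.
      by apply: (power_sums_lt (n := (p ^ m)%N)); [move=> s;
        apply: dig | rewrite card_ord].
    have L2 : (power_sums (fun i => r + q * z i) j < (b * (p ^ m) ^ k).+1)%N.
      by apply: (power_sums_lt (n := (p ^ m)%N)); [move=> s;
        apply: dig | rewrite card_ord].
    by rewrite !ltnS in L1 L2; rewrite !ltnS mulnDl addnC leqW // leq_add.
  rewrite E ler_nat leq_mul2l; apply/orP; right.
  exact: coll_congruent_le.
have Wk0 : 0 < (W ^ k)%:R :> algC by rewrite ltr0n expn_gt0.
rewrite -(ler_nat algC) -(ler_pM2l Wk0) -natrM -mom1.
have step al : `|f al| ^+ (2 * (b + k)) <=
   (2 * k)%:R ^+ (2 * (b + k)) * (\sum_i `|g al i| ^+ (2 * (b + k))) +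
   (2 * p)%:R ^+ (2 * k) * (q%:R ^+ (2 * b).-1 * \sum_(t : {ffun 'I_k -> 'I_p} |
     injectiveb t) \sum_r
      (`|h al r| ^+ (2 * b) * \prod_j `|g al (t j)| ^+ 2)).
  have := @power_sum_dichotomy _ p k b (fun i => `|g al i|) `|f al| k0 (normr_ge0 _)
    (fun i => normr_ge0 _).
  rewrite fg => /(_ (ler_norm_sum _ _ _)) /le_trans; apply.
  rewrite lerD2l ler_wpM2l ?exprn_ge0 ?ler0n // -fg.
  (* The leftover power of [|f|] is spread over the classes modulo [q] by Hölder, at the price
     [q ^ (2 b - 1)]; summing over [r] costs one more [q]. *)
  have := @power_mean _ _ (fun r : 'I_q => `|h al r|) (2 * b).-1 (fun r => normr_ge0 _).
  rewrite prednK ?muln_gt0 // card_ord => pm.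
  have {pm} pm : `|f al| ^+ (2 * b) <= q%:R ^+ (2 * b).-1 * \sum_i `|h al i| ^+ (2 * b).
    apply: le_trans pm; rewrite lerXn2r ?nnegrE ?normr_ge0 ?sumr_ge0 //.
    by rewrite fh ler_norm_sum.
  apply: le_trans (ler_wpM2r _ pm) _.
    by apply: sumr_ge0 => t _; apply: prodr_ge0 => j _; rewrite exprn_ge0.
  rewrite -mulrA ler_wpM2l ?exprn_ge0 ?ler0n // mulr_sumr; apply: ler_sum => t _.
  by rewrite mulr_suml.
apply: le_trans (ler_sum _ (fun al _ => step al)) _.
rewrite big_split /= -!mulr_sumr natrD mulrDr; apply: lerD.
  rewrite [in leRHS]natrM [((2 * k) ^ _)%:R]natrX [leRHS]mulrCA ler_wpM2l ?exprn_ge0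
    ?ler0n // exchange_big /=.
  apply: le_trans (ler_sum _ (fun i _ => mom2 i)) _.
  by rewrite sumr_const card_ord -[leLHS]mulr_natl -!natrM ler_nat mulnCA.
rewrite [in leRHS]natrM [((2 * p) ^ _)%:R]natrX [leRHS]mulrCA ler_wpM2l ?exprn_ge0
  ?ler0n //.
rewrite exchange_big /=.
under eq_bigr do rewrite exchange_big /=.
apply: le_trans (_ : q%:R ^+ (2 * b).-1 * \sum_(t : {ffun 'I_k -> 'I_p} | injectiveb
  t) \sum_(r < q) (W ^ k * (n1 ^ k * q ^ 'C(k, 2) * vinogradov k b n2))%:R <= _).
  rewrite ler_wpM2l ?exprn_ge0 ?ler0n //; apply: ler_sum => t /injectiveP ti.
  by apply: ler_sum => r _; apply: mom3.
rewrite sumr_const sumr_const card_ord -!mulrnA -natrX -!natrM ler_nat.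
set c := (n1 ^ k * _ * _)%N.
have le : (#|[pred t : {ffun 'I_k -> 'I_p} | injectiveb t]| <= p ^ k)%N.
  by rewrite (leq_trans (max_card _)) // card_ffun !card_ord.
have -> : (q ^ (2 * b) = q ^ (2 * b).-1 * q)%N by rewrite -expnSr prednK ?muln_gt0.
rewrite [leqRHS](_ : _ = q ^ (2 * b).-1 * (W ^ k * c * (q * p ^ k)))%N; last by lia.
by rewrite leq_mul2l leq_mul2l leq_mul2l le !orbT.
Qed.
End Recursion.

(** * A prime between X and 2 X^2 *)

Section Chebyshev.
Local Open Scope nat_scope.

Lemma central_bin_ge n : 2 ^ n <= 'C(2 * n, n).
Proof.
elim: n => [|n IH]; first by rewrite bin0.
rewrite mulnS expnS mul2n -addnn !addSn add0n binS.
have mono a c : 'C(a, c) <= 'C(a.+1, c) by case: c => [|c];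
  rewrite ?bin0 // binS leq_addr.
apply: leq_add; first by rewrite binS (leq_trans IH) // leq_addl.
exact: leq_trans IH (mono _ _).
Qed.

(** By Legendre's formula the exponent is a sum of terms [2n %/ p ^ i - 2 (n %/ p ^ i)], each at
    most 1 and zero once [p ^ i > 2n]. *)
Lemma central_bin_pfactor p n : prime p -> 0 < n -> p ^ logn p 'C(2 * n, n) <= 2 * n.
Proof.
move=> pp n0; have p1 := prime_gt1 pp; pose T := trunc_log p (2 * n).
have fact_eq : 'C(2 * n, n) * (n`! * n`!) = (2 * n)`!.
  by have := @bin_fact (2 * n) n; rewrite mul2n -addnn addnK; apply; rewrite leq_addr.
have E : logn p 'C(2 * n, n) + 2 * logn p n`! = logn p (2 * n)`!.
  have b0 : 0 < 'C(2 * n, n) by rewrite bin_gt0 leq_pmull.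
  by rewrite -fact_eq !lognM ?muln_gt0 ?fact_gt0 //; lia.
suff le : logn p (2 * n)`! <= 2 * logn p n`! + T.
  have : logn p 'C(2 * n, n) <= T by lia.
  rewrite -(leq_exp2l _ _ p1) => /leq_trans; apply.
  by apply: trunc_logP => //; rewrite muln_gt0.
have Tn : T <= 2 * n.
  apply: leq_trans (ltnW (ltn_expl T p1)) _.
  by apply: trunc_logP => //; rewrite muln_gt0.
rewrite !logn_fact //.
have lt2 m : n.+1 <= m -> n %/ p ^ m = 0.
  by move=> nm; apply: divn_small; exact: leq_trans nm (ltnW (ltn_expl m p1)).
have -> : \sum_(1 <= k < n.+1) n %/ p ^ k = \sum_(1 <= k < (2 * n).+1) n %/ p ^ k.
  rewrite [RHS](@big_cat_nat _ _ _ n.+1) //=; last by lia.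
  rewrite [X in _ + X]big1_seq ?addn0 // => m /=; rewrite mem_index_iota => /andP[h _].
  exact: lt2.
have -> : T = \sum_(1 <= k < (2 * n).+1) (k <= T).
  rewrite (@big_cat_nat _ _ _ T.+1) //=.
  rewrite [X in _ + X]big1_seq ?addn0 => [|m /=]; last first.
    by rewrite mem_index_iota => /andP[h _]; rewrite leqNgt h.
  rewrite (eq_big_nat _ _ (F2 := fun=> 1)) ?sum_nat_const_nat ?muln1 ?subn1 //.
  by move=> m /andP[_]; rewrite ltnS => ->.
rewrite big_distrr -big_split /=; apply: leq_sum => m _.
have [mT|Tm] := leqP m T.
  have pm : 0 < p ^ m by rewrite expn_gt0 ltnW.
  rewrite -ltnS ltn_divLR // {1}(divn_eq n (p ^ m)).
  by have := ltn_pmod n pm; nia.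
by rewrite divn_small // (leq_trans (trunc_log_ltn _ p1)) // leq_exp2l.
Qed.

(** For [n = X ^ 2], primes dividing ['C(2n, n)] are at most [2n]. If none exceeded [X], then
    [2 ^ n <= (2n) ^ X], that is [2 ^ X <= 2 X ^ 2], which fails for [X > 6]. *)
Lemma prime_below_square X : 6 < X -> exists p, [/\ prime p, X < p & p <= 2 * X ^ 2].
Proof.
move=> X6; pose n := X ^ 2; have n0 : 0 < n by rewrite expn_gt0; lia.
have [/existsP[[p pn] /= /andP[pp pX]]|/existsPn none] :=
    boolP [exists p : 'I_(2 * n).+1, prime p && (X < p)]; first by exists p.
suff : 2 ^ X <= 2 * X ^ 2.
  have : 2 * X ^ 2 < 2 ^ X.
    elim: X X6 {n n0 none} => // X IH X6.
    have [h|h] := ltnP 6 X; last by have -> : X = 6 by lia.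
    by move: (IH h); rewrite (expnS 2 X) -!mulnn; move: (2 ^ X) => Y; nia.
  by lia.
have X0 : 0 < X by lia.
rewrite -(leq_exp2r _ _ X0) -expnM mulnn.
apply: leq_trans (central_bin_ge n) _.
have b0 : 0 < 'C(2 * n, n) by rewrite bin_gt0 leq_pmull.
set c := 'C(2 * n, n) in b0 *.
have small p : logn p c != 0 -> p <= X.
  rewrite -lt0n logn_gt0 mem_primes => /and3P[pp _ pc].
  have pn : p < (2 * n).+1.
    rewrite ltnS leqNgt; apply/negP => h; move: pc; apply/negP.
    have : ~~ (p %| (2 * n)`!).
      elim: (2 * n) h => [_|m IH mp]; first by rewrite fact0 Euclid_dvd1.
      by rewrite factS Euclid_dvdM // negb_or gtnNdvd // IH // ltnW.
    apply: contra => /dvdn_trans; apply.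
    by rewrite -(@bin_fact (2 * n) n) ?leq_pmull // dvdn_mulr.
  by have := none (Ordinal pn); rewrite negb_and pp /= -leqNgt.
rewrite -(partnT b0) (@widen_partn (maxn c X)) ?leq_maxl //.
rewrite (@big_cat_nat _ _ _ X.+1) //=; last by rewrite ltnS leq_maxr.
rewrite [X in _ * X]big1_seq => [|p /=]; last first.
  rewrite mem_index_iota => /andP[Xp _]; case: eqP (small p) => [-> //|_ /(_ isT)].
  by rewrite leqNgt Xp.
rewrite muln1 big_ltn //= expn0 ?mul1n.
apply: leq_trans (_ : \prod_(1 <= i < X.+1) (2 * n) <= _); last first.
  by rewrite prod_nat_const_nat subn1.
apply: leq_prod => p _; have [pp|np] := boolP (prime p).
  exact: central_bin_pfactor.
by rewrite lognE (negPf np) muln_gt0.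
Qed.
End Chebyshev.

(** * The mean value theorem *)

Lemma vinogradov_trivial k b n : (vinogradov k b n <= n ^ (2 * b))%N.
Proof.
apply: leq_trans (max_card _) _.
by rewrite card_prod card_ffun !card_ord -expnD mul2n addnn.
Qed.

Lemma double_bin2 n : (2 * 'C(n, 2) = n * n.-1)%N.
Proof. by rewrite -mul_bin_diag bin1. Qed.

Lemma vinogradov1 k b : (vinogradov k b 1 <= 1)%N.
Proof. by rewrite (leq_trans (vinogradov_trivial _ _ _)) // exp1n. Qed.

(* Each of the [19 k] steps gains [p ^ (m (k + 1) / 40)]; [Q = p ^ (1 / 40)] keeps
   the exponents integral. *)
Section MeanValue.
Variables (p k : nat) (Q : algC).
Hypotheses (pp : prime p) (k2 : (2 <= k)%N) (kp : (8 * k ^ 2 <= p)%N).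
Hypotheses (Q1 : 1 <= Q) (Qp : Q ^+ 40 = p%:R).

Let p0 : (0 < p)%N. Proof. exact: prime_gt0. Qed.
(** The number of variables after [r] steps; it reaches [20 k ^ 2] at [r = 19 k]. *)
Let bb r := ((k + r) * k)%N.
(** The exponent of [p] lost in one step, independent of [m]. *)
Let c := (k ^ 2 + 4 * k)%N.
Let Q0 n : 0 < Q ^+ n. Proof. by rewrite exprn_gt0 // (lt_le_trans ltr01). Qed.
Let Q0' n : 0 <= Q ^+ n. Proof. exact: ltW. Qed.
Let pQ n : (p ^ n)%:R = Q ^+ (40 * n). Proof. by rewrite natrX -Qp exprM. Qed.

(** Passing from [m] to [m + 1] raises the target by [p ^ (2 bb)], which pays for the first term of
    the recursion because [p >= 8 k ^ 2]. The factor 2 reserves half of the target for the other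
    term. *)
Lemma vinogradov_descent_cost r : (r < 19 * k)%N ->
  ((2 * k) ^ (2 * bb r.+1) * p)%:R * Q ^+ (r.+1 * k.+1) * 2 <= (p ^ (2 * bb r.+1))%:R.
Proof.
move=> rk.
have tri := double_bin2 k.+1.
(* In powers of [Q] this is [(r + 1)(k + 1) <= 20 k (k + 1)], true since [r < 19 k]. *)
have q1 : Q ^+ (r.+1 * k.+1) <= (p ^ 'C(k.+1, 2))%:R.
  by rewrite pQ ler_weXn2l //; move: tri => /=; nia.
have b1 : ('C(k.+1, 2) < bb r.+1)%N by rewrite /bb; move: tri => /=; nia.
apply: le_trans (_ : ((2 * k) ^ (2 * bb r.+1) * p * p ^ 'C(k.+1, 2) * 2)%:R <= _).
  rewrite [leRHS]natrM ler_pM2r ?ltr0n // [leRHS]natrM ler_wpM2l ?ler0n //.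
rewrite ler_nat.
have b0 : (0 < bb r.+1)%N by rewrite (leq_ltn_trans _ b1).
have h1 : ((2 * k) ^ (2 * bb r.+1) * 2 <= p ^ bb r.+1)%N.
  apply: leq_trans (_ : (8 * k ^ 2) ^ bb r.+1 <= _)%N; last by rewrite leq_exp2r.
  rewrite expnM (_ : (8 * k ^ 2 = (2 * k) ^ 2 * 2)%N); last by rewrite expnMn mulnAC.
  by rewrite [leqRHS]expnMn leq_mul // (@leq_pexp2l 2 1).
have h2 : (p * p ^ 'C(k.+1, 2) <= p ^ bb r.+1)%N.
  by rewrite -expnS leq_exp2l // prime_gt1.
have -> : (p ^ (2 * bb r.+1) = p ^ bb r.+1 * p ^ bb r.+1)%N.
  by rewrite -expnD addnn mul2n.
apply: leq_trans (leq_mul h1 h2).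
by apply: eq_leq; ring.
Qed.

(** The price of the second term of the recursion, for [u] about [m / k]; again it may use only half
    of the target. *)
Lemma vinogradov_hensel_cost r m u : (r < 19 * k)%N -> (0 < m)%N ->
  (u * k <= m + k)%N ->
  ((2 * p) ^ (2 * k) * p ^ (u * 'C(k, 2)))%:R * Q ^+ (m * k.+1 + u * (r * k.+1)) * 2
    <= (p ^ (c + k * m))%:R.
Proof.
move=> rk m0 uk.
have tri := double_bin2 k.
have h1 : (2 ^ (2 * k) * 2 <= p ^ k)%N.
  apply: leq_trans (_ : 8 ^ k <= _)%N.
    by rewrite (_ : 8 = 2 ^ 3)%N // -expnM -expnSr leq_exp2l //; lia.
  by rewrite leq_exp2r; nia.
apply: le_trans (_ : (p ^ (k + 2 * k + u * 'C(k, 2)))%:R * Q ^+ (m * k.+1 + u * (r *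
  k.+1)) <= _).
  rewrite mulrAC ler_pM2r // -natrM ler_nat.
  rewrite -addnA expnD (expnD p (2 * k)) expnMn.
  by apply: leq_trans (leq_mul h1 (leqnn _)); apply: eq_leq; ring.
rewrite !pQ -exprD ler_weXn2l //.
(* Here [20 k (k - 1) + 19 k (k + 1) = k (39 k - 1)]. Adding [m (k + 1)] gives exactly [40 k m], and
   the remainder [k (39 k - 1)] with the [3 k] powers of [p] fits into [40 c]. *)
have h2 : (u * (20 * (k * k.-1) + r * k.+1) <= (m + k) * (39 * k - 1))%N.
  have : (20 * (k * k.-1) + r * k.+1 <= k * (39 * k - 1))%N by nia.
  by nia.
rewrite /c; nia.
Qed.

Lemma vinogradov_iterated r m : (r <= 19 * k)%N ->
  (vinogradov k (bb r) (p ^ m))%:R * Q ^+ (m * (r * k.+1))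
    <= (p ^ (c * r + 2 * bb r * m))%:R.
Proof.
elim: r m => [|r IHr] m rk.
  rewrite mul0n muln0 expr0 mulr1 muln0 ler_nat.
  by rewrite (leq_trans (vinogradov_trivial _ _ _)) // -expnM mulnC.
have IHr' n := IHr n (ltnW rk).
elim: m => [|m IHm].
  rewrite mul0n expr0 mulr1 muln0 addn0 ler_nat expn0.
  by rewrite (leq_trans (vinogradov1 _ _)) // expn_gt0 p0.
(* The least [u] with [m + 1 <= u k], as Hensel lifting requires. *)
pose u := ((m.+1 + k.-1) %/ k)%N.
have k0 : (0 < k)%N by lia.
have um : (m.+1 <= u * k)%N by have := ltn_ceil (m.+1 + k.-1)%N k0; rewrite -/u; nia.
have um' : (u * k <= m.+1 + k)%N by apply: leq_trans (leq_trunc_div _ _) _; lia.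
have um2 : (u <= m.+1)%N by nia.
have kp' : (k < p)%N by nia.
have b0 : (0 < bb r)%N by rewrite muln_gt0; lia.
have bS : (bb r + k = bb r.+1)%N by rewrite /bb; lia.
have := vinogradov_recursion pp kp' k0 b0 (ltn0Sn m) um um2; rewrite bS /=.
set V := vinogradov k (bb r.+1) (p ^ m.+1); rewrite -(ler_nat algC).
rewrite -(ler_pM2r (Q0 (m.+1 * (r.+1 * k.+1)))) => /le_trans; apply.
rewrite natrD mulrDl [leRHS]splitr; apply: lerD; rewrite ler_pdivlMr ?ltr0n //.
  have -> : (c * r.+1 + 2 * bb r.+1 * m.+1 = 2 * bb r.+1 + (c * r.+1 + 2 * bb r.+1 *
    m))%N by lia.
  rewrite [in leRHS]expnD [in leRHS]natrM.
  apply: le_trans (ler_pM _ _ (vinogradov_descent_cost rk) (IHm));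
    rewrite ?mulr_ge0 ?ler0n ?Q0' //.
  by rewrite (mulSn m) exprD !natrM le_eqVlt; apply/orP; left; apply/eqP; ring.
pose d := (m.+1 - u)%N; have mE : m.+1 = (d + u)%N by rewrite subnK.
rewrite -/d; set V' := vinogradov k (bb r) (p ^ d).
have -> : (p ^ (c * r.+1 + 2 * bb r.+1 * m.+1) = p ^ (c + k * m.+1) * p ^ (c * r + 2
  * bb r * d)
    * (p ^ k * p ^ (u * (2 * bb r)) * p ^ (m * k)))%N.
  by rewrite -!expnD; congr (_ ^ _)%N; rewrite /bb mE; nia.
rewrite [in leRHS]natrM [in leRHS]natrM.
have -> : ((2 * p) ^ (2 * k) * (p ^ k * ((p ^ u) ^ (2 * bb r) *
     ((p ^ m) ^ k * (p ^ u) ^ 'C(k, 2) * V'))))%:R * Q ^+ (m.+1 * (r.+1 * k.+1)) * 2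
  = (((2 * p) ^ (2 * k) * p ^ (u * 'C(k, 2)))%:R * Q ^+ (m.+1 * k.+1 + u * (r *
    k.+1)) * 2)
   * (V'%:R * Q ^+ (d * (r * k.+1))) * (p ^ k * p ^ (u * (2 * bb r)) * p ^ (m *
     k))%:R :> algC.
  have -> : (m.+1 * (r.+1 * k.+1) = (m.+1 * k.+1 + u * (r * k.+1)) + d * (r * k.+1))%N.
    by rewrite mE; lia.
  by rewrite (exprD _ (_ + _)) -!expnM !natrM; ring.
rewrite ler_wpM2r ?ler0n //.
by apply: ler_pM (vinogradov_hensel_cost rk _ um') (IHr' d);
  rewrite ?mulr_ge0 ?ler0n ?Q0'.
Qed.
End MeanValue.

(** This is the case [r = 19 k] of the iteration; its 40th power turns [Q] back into [p]. *)
Theorem vinogradov_mean_value p k m : prime p -> (2 <= k)%N -> (8 * k ^ 2 <= p)%N ->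
  (vinogradov k (20 * k ^ 2) (p ^ m) ^ 40 * (p ^ m) ^ (19 * k * k.+1)
   <= p ^ (760 * k ^ 2 * (k + 4)) * (p ^ m) ^ (1600 * k ^ 2))%N.
Proof.
move=> pp k2 kp; pose Q : algC := 40.-root p%:R.
have Qp : Q ^+ 40 = p%:R by rewrite rootCK.
have Q1 : 1 <= Q by rewrite rootC_ge1 // ler1n prime_gt0.
have := vinogradov_iterated pp k2 kp Q1 Qp m (leqnn (19 * k)).
rewrite (_ : (k + 19 * k) * k = 20 * k ^ 2)%N; last by lia.
set V := vinogradov _ _ _ => h.
rewrite -(ler_nat algC).
have -> : (V ^ 40 * (p ^ m) ^ (19 * k * k.+1))%:R
    = (V%:R * Q ^+ (m * (19 * k * k.+1))) ^+ 40 :> algC.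
  by rewrite exprMn [(Q ^+ _) ^+ _]exprAC Qp natrM natrX -expnM natrX.
have -> : (p ^ (760 * k ^ 2 * (k + 4)) * (p ^ m) ^ (1600 * k ^ 2))%:R
    = (p ^ ((k ^ 2 + 4 * k) * (19 * k) + 2 * (20 * k ^ 2) * m))%:R ^+ 40 :> algC.
  by rewrite -natrX -!expnM -expnD; congr (_ ^ _)%:R; lia.
by rewrite lerXn2r // nnegrE ?ler0n // mulr_ge0 ?ler0n // exprn_ge0 // (le_trans ler01).
Qed.

(** * Bilinear sums *)

Lemma count_multiples w m : (0 < w)%N -> (w %| m)%N ->
  (w * #|[set a : 'I_m | (w %| a)%N]| = m)%N.
Proof.
move=> w0 /dvdnP[n]; rewrite mulnC => ->; congr (_ * _)%N.
rewrite -sum1_card big_mkcond /=.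
transitivity (\sum_(a < w * n) (w %| a : nat))%N.
  by apply: eq_bigr => a _; rewrite inE; case: (w %| a)%N.
transitivity (\sum_(i < w) \sum_(y < n) (w %| i + w * y : nat))%N.
  exact: (big_digits w n (fun a => (w %| a : nat)%N)).
rewrite (bigD1 (Ordinal w0)) //= [X in (_ + X)%N]big1 ?addn0 => [|i i0].
  under eq_bigr do rewrite add0n dvdn_mulr //.
  by rewrite sum_nat_const card_ord muln1.
by apply: big1 => y _; rewrite dvdn_addl ?dvdn_mulr // gtnNdvd // lt0n.
Qed.

Section Bilinear.
Variables (C : numClosedFieldType) (W : nat) (om : C).
Hypotheses (W1 : (1 < W)%N) (om_prim : W.-primitive_root om).
Variables (k b P : nat) (c : 'I_k -> 'Z_W) (w : 'I_k -> nat).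
Hypotheses (b0 : (0 < b)%N) (w0 : forall j, (0 < w j)%N).
Hypothesis cw : forall j n, (c j * n%:R == 0) = (w j %| n)%N.

Let Y := ({ffun 'I_b -> 'I_P} * {ffun 'I_b -> 'I_P})%type.
Let ps (y : {ffun 'I_b -> 'I_P}) (j : 'I_k) : nat := power_sums (fun i => y i : nat) j.
Let lam (y : Y) (j : 'I_k) : 'Z_W := (ps y.1 j)%:R - (ps y.2 j)%:R.
Let pv (y : nat) (j : 'I_k) : nat := (y ^ j.+1)%N.
Let S (al : 'I_k -> 'Z_W) : C := \sum_(x < P) chr om (finfun al) (pv x).

(** The product bounds the number of integer vectors in a box that have prescribed residues modulo
    the [w j]; the mean value bounds the representations of each. *)
Let M := (\prod_(j < k) ((2 * b * P ^ j.+1) %/ w j).+1 * vinogradov k b P)%N.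

Lemma card_weighted_class (mu : 'I_k -> 'Z_W) :
  (#|[set y : Y | [forall j, (c j * lam y j)%R == (c j * mu j)%R]]| <= M)%N.
Proof.
set A := [set y | _].
pose N := (2 * b * P ^ k)%N.
(* Adding [b * P ^ j.+1] keeps the difference of power sums in the natural numbers. *)
pose v (y : Y) (j : 'I_k) : nat := (ps y.1 j + (b * P ^ j.+1 - ps y.2 j))%N.
have psle y j : (ps y j <= b * P ^ j.+1)%N.
  rewrite -[X in (X * _)%N](card_ord b) -sum_nat_const; apply: leq_sum => i _.
  by rewrite leq_exp2r // ltnW.
have vle y j : (v y j <= 2 * b * P ^ j.+1)%N.
  by have := psle y.1 j; rewrite /v; lia.
have vlt y j : (v y j < N.+1)%N.
  rewrite ltnS (leq_trans (vle y j)) // leq_mul2l; apply/orP; right.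
  have [->|P0] := posnP P; first by rewrite exp0n.
  by rewrite leq_pexp2l.
pose phi (y : Y) := [ffun j => Ordinal (vlt y j)].
rewrite /M; apply: leq_trans (_ : #|phi @: A| * vinogradov k b P <= _)%N.
  apply: (card_le_fibers (f := phi)) => [y yA|s]; first exact: imset_f.
  pose zw (z : {ffun 'I_b -> 'I_P}) (j : 'I_k) : int := (ps z j)%:Z.
  apply: leq_trans (_ : coll zw <= _)%N; last first.
    by apply: coll_le => z z' E j; apply/eqP; rewrite -eqz_nat; apply/eqP/E.
  apply: leq_trans (card_shifted_matches zw (fun j => (s j)%:Z - (b * P ^ j.+1)%N%:Z)).
  apply/subset_leq_card/subsetP => y; rewrite !inE => /andP[_ /eqP <-].
  apply/forallP => j; rewrite ffunE /zw /v /=; apply/eqP.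
  by have := psle y.2 j; move: (ps _ _) (ps _ _) (b * _)%N => *; lia.
rewrite leq_mul2r; apply/orP; right.
apply: (card_le_residues (F := fun (s : {ffun 'I_k -> 'I_N.+1}) j => (s j %/ w
  j)%N%:Z)) => //.
move=> s s' /imsetP[y yA ->] /imsetP[y' yA' ->] E; apply/ffunP => j; rewrite !ffunE.
apply/val_inj => /=; have := E j; rewrite !ffunE /= => {}E.
have vw0 z z' : z \in A -> z' \in A -> (v z' j <= v z j)%N -> (v z j = v z' j %[mod w
  j])%N.
  move=> zA zA' le; apply/eqP.
  rewrite eqn_mod_dvd // -cw natrB // mulrBr subr_eq0.
  have vE x : x \in A -> c j * (v x j)%:R = c j * mu j + c j * (b * P ^ j.+1)%:R.
    rewrite inE => /forallP/(_ j)/eqP <-.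
    by rewrite /v natrD natrB ?psle // /lam; ring.
  by rewrite !vE.
have vw : (v y j = v y' j %[mod w j])%N.
  by case/orP: (leq_total (v y' j) (v y j)) => le; [|symmetry]; exact: vw0.
have lt z : (v z j %/ w j < ((2 * b * P ^ j.+1) %/ w j).+1)%N by rewrite ltnS leq_div2r.
have div : (v y j %/ w j = v y' j %/ w j)%N.
  move: E; rewrite -eqz_mod_dvd !modz_small /= ?ltz_nat ?lt //.
  by move/eqP => [].
by rewrite (divn_eq (v y j) (w j)) div vw -divn_eq.
Qed.

Lemma card_annihilator (a : 'Z_W) (j : 'I_k) :
  (w j * #|[set d : 'Z_W | (c j * d)%R == (c j * a)%R]| = W)%N.
Proof.
have wW : (w j %| (Zp_trunc W).+2)%N by rewrite Zp_cast // -cw pchar_Zp // mulr0.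
apply: etrans (etrans _ (count_multiples (w0 j) wW)) (Zp_cast W1); congr (_ * _)%N.
rewrite -(card_imset _ (addIr (- a))); apply: eq_card => d.
rewrite inE; apply/imsetP/idP => [[e]|wd].
  by rewrite inE -subr_eq0 -mulrBr => h ->; rewrite -cw natr_Zp.
exists (d + a); last by rewrite addrK.
by rewrite inE -subr_eq0 -mulrBr addrK -(natr_Zp d) cw.
Qed.

Lemma normS_pow al : `|S al| ^+ (2 * b) = \sum_(y : Y) psi om (\sum_j al j * lam y j).
Proof.
rewrite mulnC exprM -normrX -[in LHS](card_ord b) -prodr_const /S.
rewrite (prod_sum_chr W1 om_prim (finfun al) P (fun _ => pv)).
rewrite (normsq_sum_psi W1 om_prim); apply: eq_bigr => y _; congr psi.
by rewrite -sumrB; apply: eq_bigr => j _; rewrite ffunE mulrBr.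
Qed.

(** Hölder in [x], expansion of the [2 b]-th power, Hölder in [y] and Cauchy-Schwarz lead to the sum
    of [G (lam y) ^ 2]. This is compared with the sum over all [mu], which Parseval evaluates. *)
Lemma bilinear_bound :
  `|\sum_(x < P) \sum_(y < P) psi om (\sum_j c j * (x ^ j.+1 * y ^ j.+1)%N%:R)| ^+ (8
    * b ^ 2)
    * (P ^ (4 * b))%:R
  <= (P ^ (16 * b ^ 2) * \prod_(j < k) w j * M ^ 2)%:R.
Proof.
set T := \sum_(x < P) _.
pose cS (mu : 'I_k -> 'Z_W) := S (fun j => c j * mu j).
pose G mu := `|cS mu| ^+ (2 * b).
have G0 mu : 0 <= G mu by rewrite exprn_ge0.
have b2 : (2 * b).-1.+1 = (2 * b)%N by rewrite prednK // muln_gt0.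
have cY : #|[set: Y]| = (P ^ (2 * b))%N.
  by rewrite cardsT card_prod card_ffun !card_ord -expnD addnn mul2n.
have T1 : `|T| ^+ (2 * b) <= (P ^ (2 * b).-1)%:R * \sum_y `|cS (lam y)|.
  have := @power_mean _ _ (fun x : 'I_P => `|S (fun j => c j * (x ^ j.+1)%:R)|) (2 *
    b).-1 (fun x => normr_ge0 _).
  rewrite b2 card_ord -natrX => pm; apply: le_trans (le_trans pm _).
    rewrite lerXn2r ?nnegrE ?sumr_ge0 //; apply: le_trans (ler_norm_sum _ _ _) _.
    apply: ler_sum => x _; rewrite le_eqVlt; apply/orP; left; apply/eqP; congr `|_|.
    apply: eq_bigr => y _; congr psi; apply: eq_bigr => j _.
    by rewrite ffunE natrM mulrA.
  rewrite ler_wpM2l ?ler0n //.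
  rewrite -[leLHS]ger0_norm; last by apply: sumr_ge0 => x _; rewrite exprn_ge0.
  under eq_bigr do rewrite normS_pow.
  rewrite exchange_big /=; apply: le_trans (ler_norm_sum _ _ _) _.
  apply: ler_sum => y _; rewrite le_eqVlt; apply/orP; left; apply/eqP; congr `|_|.
  apply: eq_bigr => x _; congr psi; apply: eq_bigr => j _.
  by rewrite ffunE mulrAC.
have T2 : `|T| ^+ (2 * b * (2 * b)) <=
    (P ^ ((2 * b).-1 * (2 * b)))%:R * ((P ^ (2 * b * (2 * b).-1))%:R * \sum_y G (lam
      y)).
  have := @power_mean _ _ (fun y : Y => `|cS (lam y)|) (2 * b).-1 (fun x => normr_ge0
    _).
  rewrite b2 -cardsT cY -natrX -expnM => pm.
  rewrite exprM; apply: le_trans (_ : ((P ^ (2 * b).-1)%:R * \sum_y `|cS (lam y)|) ^+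
    (2 * b) <= _).
    by rewrite lerXn2r ?nnegrE ?exprn_ge0 // mulr_ge0 ?ler0n ?sumr_ge0.
  by rewrite exprMn -natrX -expnM ler_wpM2l ?ler0n.
have D2 : (\sum_y G (lam y)) ^+ 2 <= (P ^ (2 * b))%:R * \sum_y G (lam y) ^+ 2.
  have := @power_mean _ _ (fun y : Y => G (lam y)) 1 (fun x => G0 _).
  by rewrite -cardsT cY expr1.
(* [G mu] depends only on the products [c j * mu j]; [An] is the number of [mu] with given
   products. *)
pose An := (\prod_(j < k) #|[set d : 'Z_W | (c j * d)%R == (c j * 0)%R]|)%N.
have AnW : (W ^ k = \prod_(j < k) w j * An)%N.
  rewrite -big_split /= -[X in (_ ^ X)%N](card_ord k) -prod_nat_const.
  by apply: eq_bigr => j _; rewrite card_annihilator.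
have An0 : (0 < An)%N.
  have : (0 < W ^ k)%N by rewrite expn_gt0 ltnW.
  by rewrite AnW muln_gt0 => /andP[].
have fibre (y : Y) : #|[set mu : {ffun 'I_k -> 'Z_W} | [forall j, (c j * mu j)%R ==
  (c j * lam y j)%R]]| = An.
  transitivity #|(family (fun j : 'I_k => [pred d : 'Z_W | (c j * d)%R == (c j * lam
    y j)%R]) : pred {ffun 'I_k -> 'Z_W})|.
    by apply: eq_card => mu; rewrite inE; apply/forallP/familyP.
  rewrite card_family foldrE big_map big_enum /=; apply: eq_bigr => j _.
  apply/eqP; rewrite -(eqn_pmul2l (w0 j)) (card_annihilator 0).
  by have := card_annihilator (lam y j) j; rewrite cardsE => ->.
(* [G] is itself a character sum over [Y], so its mean square counts pairs with equal
   [c j * lam y j]. *)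
have moment : \sum_(mu : {ffun 'I_k -> 'Z_W}) G mu ^+ 2 <= (W ^ k * (P ^ (2 * b) *
  M))%:R.
  have E : \sum_(mu : {ffun 'I_k -> 'Z_W}) G mu ^+ 2 = (W ^ k * coll (fun (y : Y) j
    => c j * lam y j))%:R.
    rewrite -(parseval W1 om_prim); apply: eq_bigr => mu _.
    rewrite -[G mu]ger0_norm // /G normS_pow; congr (`|_| ^+ _).
    apply: eq_bigr => y _; congr psi; apply: eq_bigr => j _; ring.
  rewrite E ler_nat leq_mul2l; apply/orP; right; rewrite -cY.
  apply: (card_le_fibers (f := fun yy : Y * Y => yy.2)) => [yy _|y];
    first by rewrite inE.
  apply: leq_trans (card_weighted_class (lam y)).
  rewrite -(card_in_imset (f := fun yy : Y * Y => yy.1)); last first.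
    by move=> [y1 y2] [z1 z2]; rewrite !inE /= => /andP[_ /eqP ->] /andP[_ /eqP ->] ->.
  apply/subset_leq_card/subsetP => z /imsetP[[y1 y2]]; rewrite !inE /=.
  by move=> /andP[h /eqP <-] ->.
have X : \sum_y G (lam y) ^+ 2 <= (\prod_(j < k) w j * P ^ (2 * b) * M ^ 2)%:R.
  have An0' : 0 < An%:R :> C by rewrite ltr0n.
  rewrite -(ler_pM2l An0').
  apply: le_trans (_ : M%:R * \sum_(mu : {ffun 'I_k -> 'Z_W}) G mu ^+ 2 <= _);
    last first.
    apply: le_trans (ler_wpM2l (ler0n _ _) moment) _.
    by rewrite -!natrM ler_nat AnW; apply: eq_leq; ring.
  rewrite !mulr_sumr.
  (* Each [G (lam y) ^ 2] is spread over its [An] equivalent [mu]; every [mu] is then hit by at most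
     [M] of the [y]. *)
  apply: le_trans (_ : \sum_(y : Y) \sum_(mu : {ffun 'I_k -> 'Z_W} | [forall j, (c j
    * mu j)%R == (c j * lam y j)%R]) G mu ^+ 2 <= _).
    apply: ler_sum => y _; rewrite -(fibre y) mulr_natl -sumr_const.
    rewrite (eq_bigl (fun mu : {ffun 'I_k -> 'Z_W} => [forall j, (c j * mu j)%R == (c
      j * lam y j)%R])) => [|mu]; last by rewrite inE.
    apply: ler_sum => mu /forallP h; rewrite le_eqVlt; apply/orP; left; apply/eqP.
    rewrite /G /cS /S; congr (`|_| ^+ _ ^+ _); apply: eq_bigr => x _; congr psi.
    by apply: eq_bigr => j _; rewrite !ffunE (eqP (h j)).
  rewrite (exchange_big_dep predT) //=; apply: ler_sum => mu _.
  rewrite sumr_const -[leLHS]mulr_natl ler_wpM2r ?exprn_ge0 // ler_nat.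
  apply: leq_trans (card_weighted_class mu); apply: subset_leq_card.
  by apply/subsetP => y; rewrite !inE unfold_in => /forallP h; apply/forallP => j;
    rewrite eq_sym.
have -> : (8 * b ^ 2 = 2 * b * (2 * b) * 2)%N by rewrite -mulnn; ring.
rewrite exprM.
apply: le_trans (_ : ((P ^ ((2 * b).-1 * (2 * b)))%:R * ((P ^ (2 * b * (2 *
  b).-1))%:R * \sum_y G (lam y))) ^+ 2 * (P ^ (4 * b))%:R <= _).
  rewrite ler_wpM2r ?ler0n // lerXn2r // ?nnegrE ?exprn_ge0 // !mulr_ge0 ?ler0n //.
  by apply: sumr_ge0.
rewrite !exprMn.
apply: le_trans (_ : (P ^ ((2 * b).-1 * (2 * b)))%:R ^+ 2 * ((P ^ (2 * b * (2 *
  b).-1))%:R ^+ 2 *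
   ((P ^ (2 * b))%:R * (\prod_(j < k) w j * P ^ (2 * b) * M ^ 2)%:R)) * (P ^ (4 *
     b))%:R <= _).
  rewrite ler_wpM2r ?ler0n // !ler_wpM2l ?exprn_ge0 ?ler0n //.
  by apply: le_trans D2 _; rewrite ler_wpM2l ?ler0n.
rewrite -!natrX -!natrM ler_nat; apply: eq_leq.
have -> : (16 * b ^ 2 = (2 * b).-1 * (2 * b) * 2 + 2 * b * (2 * b).-1 * 2 + 2 * b + 2
  * b + 4 * b)%N.
  have -> : (16 * b ^ 2 = 4 * ((2 * b) * (2 * b)))%N by rewrite -mulnn; ring.
  have -> : (4 * b = 2 * (2 * b))%N by ring.
  by rewrite -b2 /=; move: (2 * b).-1 => d; ring.
by rewrite !expnD !(expnM _ _ 2); ring.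
Qed.
End Bilinear.

(** * 2-adic expansion of inversive sequences *)

(* [s j - v_2(j!)] *)
Definition expansion_val s j : nat := (\sum_(1 <= i < j.+1) (s - logn 2 i))%N.

Lemma expansion_valS s j :
  expansion_val s j.+1 = (expansion_val s j + (s - logn 2 j.+1))%N.
Proof. by rewrite /expansion_val big_nat_recr. Qed.

Lemma logn2_lt j : (logn 2 j.+1 < j.+1)%N.
Proof.
by apply: leq_trans (ltn_expl _ (isT : 1 < 2)%N) (dvdn_leq _ (pfactor_dvdnn 2 _)).
Qed.

Lemma odd_part2 n : odd (n`_2^')%N.
Proof. by have := part_pnat (2^')%N n; rewrite p'natE // dvdn2 negbK. Qed.

(** The increment [s - logn 2 l] is positive for [0 < l <= s], because [logn 2 l < l]. *)
Lemma expansion_val_lt s j l : (j < l)%N -> (l <= s)%N -> (expansion_val s j <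
  expansion_val s l)%N.
Proof.
move=> jl ls; rewrite -(subnKC jl); move: (l - j.+1)%N (subnKC jl) => d.
elim: d l ls {jl} => [|d IH] l ls E; rewrite ?addn0 ?addnS expansion_valS.
  by have := logn2_lt j; lia.
by have := IH l.-1; have := logn2_lt (j.+1 + d); lia.
Qed.

Lemma expansion_val_ge s k j : (j <= k)%N -> ((s - k) * j <= expansion_val s j)%N.
Proof.
elim: j => [|j IH] jk; first by rewrite muln0.
rewrite expansion_valS mulnS addnC leq_add //; first exact/IH/ltnW.
by have := logn2_lt j; lia.
Qed.

Lemma expansion_val_le s j : (expansion_val s j <= s * j)%N.
Proof.
elim: j => [|j IH]; first by rewrite /expansion_val big_geq.
by rewrite expansion_valS mulnS; lia.
Qed.

Section Expansion.
Variables (A : comUnitRingType) (t : nat).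
Hypothesis two_nil : (2 : A) ^+ t = 0.

Lemma inv_1_sub_even (z : A) : (1 - 2 * z) * \sum_(i < t) (2 * z) ^+ i = 1.
Proof.
have := subrX1 (2 * z) t; rewrite exprMn two_nil mul0r sub0r => /(congr1 -%R).
by rewrite opprK -mulNr opprB => <-.
Qed.

Lemma unitrD_even (u z : A) : u \is a GRing.unit -> u + 2 * z \is a GRing.unit.
Proof.
move=> uu; have -> : u + 2 * z = u * (1 - 2 * (- (z / u))).
  by rewrite mulrBr mulr1 mulrCA mulrN mulrCA divrr // mulr1 mulrN opprK.
by rewrite unitrM uu; apply/unitrPr; exists (\sum_(i < t) (2 * (- (z / u))) ^+ i);
  exact: inv_1_sub_even.
Qed.

Lemma unitr_odd n : odd n -> (n%:R : A) \is a GRing.unit.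
Proof.
move=> on; rewrite -(odd_double_half n) on natrD -mul2n natrM.
exact/unitrD_even/unitr1.
Qed.

(** The falling factorial [X (X - 1) ... (X - l + 1)], equal to [l!] times the binomial
    polynomial. *)
Definition ffpoly l : {poly A} := \prod_(i < l) ('X - (i%:R)%:P).

Lemma horner_ffpoly l n : (ffpoly l).[n%:R] = (n ^_ l)%:R.
Proof.
elim: l => [|l IH]; first by rewrite /ffpoly big_ord0 hornerC.
rewrite /ffpoly big_ord_recr /= hornerM -/(ffpoly l) IH hornerXsubC ffactnSr natrM.
have [ln|nl] := leqP l n; first by rewrite natrB.
by rewrite ffact_small ?mul0r.
Qed.

Lemma size_ffpoly l : size (ffpoly l) = l.+1.
Proof. by rewrite /ffpoly size_prod_XsubC -sum1_size sum1_card card_ord. Qed.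

Lemma monic_ffpoly l : ffpoly l \is monic.
Proof. exact: monic_prod_XsubC. Qed.

Variables (s k : nat) (v : A).
Hypotheses (vu : v \is a GRing.unit) (ks : (k <= s)%N) (sk : (t <= (s - k) * k)%N)
  (k0 : (0 < k)%N) (t0 : (0 < t)%N).
Let H : A := 1 + 2 ^+ s * v.
Let e := expansion_val s.

(* The odd part of [(2 ^ s v) ^ l / l!], its power of two being [2 ^ e l]. *)
Fixpoint divided_power l : A :=
  if l is l'.+1 then divided_power l' * (v / (l`_2^')%N%:R) else 1.

Lemma divided_power_unit l : divided_power l \is a GRing.unit.
Proof.
elim: l => [|l IH]; first exact: unitr1.
rewrite unitrM IH unitrM vu unitrV; exact/unitr_odd/odd_part2.
Qed.

Lemma divided_powerE l : (l <= k)%N ->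
  2 ^+ e l * divided_power l * (l`!)%:R = (2 ^+ s * v) ^+ l.
Proof.
elim: l => [|l IH] lk; first by rewrite /e /expansion_val big_geq // expr0 !mul1r.
rewrite exprSr -IH 1?ltnW // /e expansion_valS factS natrM -[in (l.+1)%:R](partnC 2%N
  (ltn0Sn l)).
rewrite natrM p_part natrX /= exprD.
have E : 2 ^+ s = 2 ^+ (s - logn 2 l.+1) * 2 ^+ logn 2 l.+1 :> A.
  by rewrite -exprD subnK //; have := logn2_lt l; lia.
have u : (l.+1`_2^')%N%:R \is a @GRing.unit A.
  exact/unitr_odd/odd_part2.
move: (_%:R) u => o u; rewrite E.
rewrite -[RHS]mulr1 -(divrr u); ring.
Qed.

Lemma exprH n : H ^+ n = \sum_(l < k.+1) 2 ^+ e l * divided_power l * (ffpoly l).[n%:R].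
Proof.
(* The binomial sum may stop at [n], where the binomial coefficients vanish, or at [k], since
   [2 ^ (s l)] is 0 for [l > k]. *)
have trunc m m' : (m <= m')%N ->
    (forall l, (m < l)%N -> (2 ^+ s * v) ^+ l *+ 'C(n, l) = 0) ->
    \sum_(l < m'.+1) (2 ^+ s * v) ^+ l *+ 'C(n, l) = \sum_(l < m.+1) (2 ^+ s * v) ^+
      l *+ 'C(n, l).
  move=> mm' z; rewrite -!(big_mkord predT (fun l => (2 ^+ s * v) ^+ l *+ 'C(n, l))).
  rewrite (@big_cat_nat _ _ _ m.+1) //= [X in _ + X]big1_seq ?addr0 // => l.
  by rewrite mem_index_iota => /andP[_ /andP[ml _]]; exact: z.
have -> : H ^+ n = \sum_(l < k.+1) (2 ^+ s * v) ^+ l *+ 'C(n, l).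
  have -> : H ^+ n = \sum_(l < n.+1) (2 ^+ s * v) ^+ l *+ 'C(n, l).
    by rewrite exprDn; apply: eq_bigr => l _; rewrite expr1n mul1r.
  rewrite -(trunc n (maxn n k)) ?leq_maxl //; last by move=> l nl;
    rewrite bin_small ?mulr0n.
  rewrite (trunc k) ?leq_maxr // => l kl; rewrite exprMn -exprM.
  have -> : (s * l = t + (s * l - t))%N by nia.
  by rewrite exprD two_nil !mul0r mul0rn.
apply: eq_bigr => -[l lk] _ /=; rewrite -divided_powerE // horner_ffpoly.
by rewrite -bin_ffact natrM -mulr_natr; ring.
Qed.

(** The term [l = j] is [2 ^ e j] times a unit, [ffpoly j] being monic; lower terms have no
    coefficient at [j], and higher ones carry a larger power of 2. *)
Lemma divided_power_tail j : (j <= k)%N ->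
  exists2 u, u \is a GRing.unit &
    \sum_(l < k.+1) 2 ^+ e l * divided_power l * (ffpoly l)`_j = 2 ^+ e j * u.
Proof.
move=> jk; pose d l := if (j < l)%N then 2 ^+ (e l - e j).-1 * divided_power l *
  (ffpoly l)`_j else 0.
exists (divided_power j + 2 * \sum_(l < k.+1) d l).
  exact/unitrD_even/divided_power_unit.
rewrite (bigD1 (Ordinal (jk : j < k.+1)%N)) //= mulrDr.
have -> : (ffpoly j)`_j = 1.
  by have := monic_ffpoly j; rewrite monicE /lead_coef size_ffpoly => /eqP.
rewrite mulr1; congr (_ + _); rewrite [in RHS](bigD1 (Ordinal (jk : j < k.+1)%N)) //=.
rewrite /d ltnn add0r !mulr_sumr; apply: eq_bigr => l lj.
have {}lj : (l : nat) != j by [].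
case: ltnP => [jl|lej]; last first.
  by rewrite nth_default ?mulr0 // size_ffpoly ltn_neqAle lj.
have h := expansion_val_lt jl (leq_trans (ltn_ord l : (l <= k)%N) ks).
have -> : 2 ^+ e l = 2 ^+ e j * (2 * 2 ^+ (e l - e j).-1) :> A.
  by rewrite -exprS prednK ?subn_gt0 // -exprD subnKC // ltnW.
by rewrite !mulrA.
Qed.

(** The geometric series gives [a / gn] times the sum of [(2 y) ^ i H ^ (n (i + 1))], and each power
    of [H] is a polynomial in [n (i + 1)]. The units [U] serve all [n] at once. *)
Lemma inversive_expansion (a gn b : A) :
  a \is a GRing.unit -> gn \is a GRing.unit ->
  exists2 U : nat -> A, (forall j, (j <= k)%N -> U j \is a GRing.unit) &
    forall G n, G * H = 1 ->
      a / (gn * G ^+ n - 2 * b) = \sum_(j < k.+1) U j * 2 ^+ e j * n%:R ^+ j.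
Proof.
move=> au gu; pose y := b / gn.
have tail (j : 'I_k.+1) : {u | u \is a GRing.unit &
    \sum_(l < k.+1) 2 ^+ e l * divided_power l * (ffpoly l)`_j == 2 ^+ e j * u}.
  apply/sig2W; have [u uu E] := divided_power_tail (ltn_ord j : (j <= k)%N).
  by exists u; rewrite ?E.
pose wt j := \sum_(i < t) (2 * y) ^+ i * i.+1%:R ^+ j.
(* The term [i = 0] is 1 and all others are even. *)
have wu j : wt j \is a GRing.unit.
  rewrite /wt; case: t t0 => // t' _; rewrite big_ord_recl expr0 mul1r expr1n.
  under eq_bigr do rewrite exprS -!mulrA.
  by rewrite -mulr_sumr; exact/unitrD_even/unitr1.
exists (fun j => a / gn * wt j * s2val (tail (inord j))).
  by move=> j jk; rewrite !unitrM wu au unitrV gu (s2valP (tail (inord j))).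
move=> G n GH.
have Hn : G ^+ n * H ^+ n = 1 by rewrite -exprMn GH expr1n.
have -> : a / (gn * G ^+ n - 2 * b) = a / gn * (H ^+ n * \sum_(i < t) (2 * (y * H ^+
  n)) ^+ i).
  have Gu : G ^+ n \is a GRing.unit by apply/unitrPr; exists (H ^+ n).
  have D : gn * G ^+ n - 2 * b = gn * G ^+ n * (1 - 2 * (y * H ^+ n)).
    rewrite mulrBr mulr1; congr (_ - _); rewrite /y.
    transitivity (2 * b * (gn / gn) * (G ^+ n * H ^+ n)); last by ring.
    by rewrite Hn divrr // !mulr1.
  have S1 := inv_1_sub_even (y * H ^+ n).
  have Iu : 1 - 2 * (y * H ^+ n) \is a GRing.unit by apply/unitrPr; eexists; exact: S1.
  rewrite D -[RHS]mulrA; congr (_ * _).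
  apply: (@mulrI _ (gn * G ^+ n * (1 - 2 * (y * H ^+ n))));
    first by rewrite !unitrM gu Gu.
  rewrite divrr ?unitrM ?gu ?Gu //.
  transitivity (gn / gn * (G ^+ n * H ^+ n) * ((1 - 2 * (y * H ^+ n)) * \sum_(i < t)
    (2 * (y * H ^+ n)) ^+ i)).
    by rewrite divrr // Hn S1 !mulr1.
  ring.
rewrite mulr_sumr.
under eq_bigr => i _.
  rewrite mulrA exprMn mulrCA -exprM -exprD -mulnS exprH mulr_sumr.
  under eq_bigr => l _.
    rewrite (@horner_coef_wide _ k.+1) ?size_ffpoly // mulr_sumr mulr_sumr.
    over.
  rewrite exchange_big /=; over.
rewrite exchange_big mulr_sumr /=; apply: eq_bigr => j _.
rewrite inord_val.
case: (tail j) => u uu /= /eqP tu.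
have -> : a / gn * wt j * u * 2 ^+ e j * n%:R ^+ j = a / gn * (wt j * (2 ^+ e j * u)
  * n%:R ^+ j).
  by ring.
congr (_ * _); rewrite -tu /wt !mulr_suml; apply: eq_bigr => i _.
rewrite mulr_sumr mulr_suml; apply: eq_bigr => l _.
by rewrite natrM [(n%:R * _) ^+ j]exprMn; ring.
Qed.
End Expansion.

(** * Residues modulo 2^t *)

Lemma coprimez2 (w : int) : coprimez w 2 = ~~ (2 %| w)%Z.
Proof. by rewrite dvdzE dvdn2 negbK -coprimen2 /coprime /coprimez /gcdz. Qed.

(** Squaring [1 + w 2 ^ n] gives [1 + (w + w ^ 2 2 ^ (n - 1)) 2 ^ (n + 1)], whose cofactor stays odd
    for [n >= 2]. *)
Lemma dyadic_square_power (g w : int) beta j : (2 <= beta)%N -> coprimez w 2 ->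
  g ^+ 2 = 1 + w * 2 ^+ beta ->
  exists2 w' : int, coprimez w' 2 & g ^+ (2 ^ j.+1) = 1 + w' * 2 ^+ (beta + j).
Proof.
move=> b2 cw gE; elim: j => [|j [w' cw' IH]]; first by exists w; rewrite ?addn0.
exists (w' + 2 * (w' ^+ 2 * 2 ^+ (beta + j - 2))).
  by rewrite !coprimez2 in cw' *; rewrite rpredDr ?dvdz_mulr.
rewrite expnSr exprM IH.
have -> : 2 ^+ (beta + j.+1) = 2 ^+ (beta + j) * 2 :> int by rewrite addnS exprSr.
have -> : 2 ^+ (beta + j) = 2 ^+ (beta + j - 2) * 4 :> int.
  by rewrite (_ : 4%:R = 2%:R ^+ 2) // -exprD subnK //; lia.
ring.
Qed.

Section Residues.
Variable t : nat.
Hypothesis t0 : (0 < t)%N.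
Local Notation A := 'Z_(2 ^ t).

Let W1 : (1 < 2 ^ t)%N. Proof. by rewrite -{1}(expn0 2) ltn_exp2l. Qed.

Lemma two_nilpotent : (2 : A) ^+ t = 0.
Proof. by rewrite -natrX pchar_Zp. Qed.

Lemma odd_unit (x : A) : coprime x 2 -> x \is a GRing.unit.
Proof. by move=> cx; rewrite -(natr_Zp x) unitZpE // coprime_sym coprimeXr. Qed.

Lemma odd_int_unit (h : int) : coprimez h 2 -> (h%:~R : A) \is a GRing.unit.
Proof.
move=> ch; rewrite [h]intEsign rmorphM rmorph_sign unitrM unitrX ?unitrN1 //=.
by apply: (unitr_odd two_nilpotent); move: ch; rewrite /coprimez /gcdz /= -coprimen2.
Qed.

Lemma even_residue (b : A) : (b = 0 %[mod 2])%N -> exists b', b = 2 * b'.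
Proof.
move=> bE; exists (b %/ 2)%N%:R.
by rewrite -natrM mulnC divnK ?natr_Zp // /dvdn bE.
Qed.

Lemma power_of_two_annihilates e n (u : A) : u \is a GRing.unit ->
  (u * 2 ^+ e * n%:R == 0) = (2 ^ (t - e) %| n)%N.
Proof.
move=> uu; rewrite -mulrA -[RHS]orbF; set r := RHS.
have -> : (u * (2 ^+ e * n%:R) == 0) = ((2 ^ e * n)%:R == 0 :> A).
  rewrite natrM natrX; apply/eqP/eqP => [|->]; last by rewrite mulr0.
  by move=> h; apply: (mulrI uu); rewrite mulr0.
have -> m : (m%:R == 0 :> A) = (2 ^ t %| m)%N.
  by rewrite -(inj_eq val_inj) /= val_Zp_nat.
rewrite /r orbF; have [te|et] := leqP t e.
  by rewrite (eqP te) expn0 dvd1n dvdn_mulr // dvdn_exp2l.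
by rewrite -{1}(subnKC (ltnW et)) expnD dvdn_pmul2l // expn_gt0.
Qed.

(** If [G = 1 + 2 ^ s w'] is the power of [g], then [v = - w' / G] works, for
    [G (1 + 2 ^ s v) = G - 2 ^ s w']. *)
Lemma inverse_of_square_power (g : A) (w : int) beta s : (2 <= beta)%N -> (beta <=
  s)%N ->
  coprime g 2 -> coprimez w 2 -> (g : nat)%:Z ^+ 2 = 1 + w * 2 ^+ beta ->
  exists2 v : A, v \is a GRing.unit & g ^+ (2 ^ (s - beta).+1) * (1 + 2 ^+ s * v) = 1.
Proof.
move=> b2 bs cg cw gE.
have [w' cw' E] := dyadic_square_power (s - beta) b2 cw gE.
have gu := odd_unit cg; rewrite subnKC // in E.
set G := g ^+ _.
have Gu : G \is a GRing.unit by rewrite unitrX.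
have GE : G = 1 + 2 ^+ s * w'%:~R.
  have := congr1 (fun z : int => z%:~R : A) E.
  have gZ : (g : nat)%:Z%:~R = g by rewrite -pmulrn natr_Zp.
  by rewrite rmorphXn rmorphD rmorphM rmorphXn /= gZ /G => ->; rewrite mulrC.
exists (- (w'%:~R / G)).
  by rewrite unitrN unitrM odd_int_unit // unitrV.
have GV : G * G^-1 = 1 by rewrite divrr.
transitivity (G - 2 ^+ s * w'%:~R * (G * G^-1)); first by ring.
by rewrite GV GE; ring.
Qed.
End Residues.

Local Open Scope complex_scope.

(** * The exponential e and characters modulo 2^t *)

Section UnitCircle.
Variable R : realType.

Lemma eE (z : R) : e z = (cos (2 * pi * z) +i* sin (2 * pi * z)).
Proof.
rewrite /e /cexp.
have -> : 2 * pi%:C * 'i * z%:C = 0 +i* (2 * pi * z) :> R[i].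
  apply/eqP; rewrite eq_complex /=; apply/andP; split; apply/eqP; ring.
by rewrite /= expR0 mul1r.
Qed.

Lemma eD (x y : R) : e (x + y) = e x * e y.
Proof.
rewrite !eE mulrDr cosD sinD.
by apply/eqP; rewrite eq_complex /=; apply/andP; split; apply/eqP; ring.
Qed.

Lemma e0 : e (0 : R) = 1. Proof. by rewrite eE mulr0 cos0 sin0. Qed.

Lemma eMn (x : R) n : e (x *+ n) = e x ^+ n.
Proof. by elim: n => [|n IH]; rewrite ?mulr0n ?e0 // mulrS eD IH exprS. Qed.

Lemma e_half : e (2^-1 : R) = -1.
Proof.
rewrite eE [2 * pi]mulrC -mulrA divff ?mulr1 ?pnatr_eq0 // cospi sinpi.
by apply/eqP; rewrite eq_complex /= oppr0 !eqxx.
Qed.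

Lemma e1 : e (1 : R) = 1.
Proof.
have -> : (1 : R) = 2^-1 *+ 2 by rewrite -[RHS]mulr_natl divff // pnatr_eq0.
by rewrite eMn e_half sqrrN expr1n.
Qed.

Lemma e_int (m : int) : e (m%:~R : R) = 1.
Proof.
have eN x : e x = 1 -> e (- x : R) = 1.
  by move=> h; have := e0; rewrite -{1}(subrr x) eD h mul1r.
case: m => n; first by rewrite -pmulrn eMn e1 expr1n.
by rewrite NegzE mulrNz; apply: eN; rewrite -pmulrn eMn e1 expr1n.
Qed.

(** The order divides [2 ^ t]; a smaller one would divide [2 ^ (t - 1)], but that power is
    [e (1 / 2) = -1]. *)
Lemma e_prim t : (0 < t)%N -> (2 ^ t).-primitive_root (e ((2 ^+ t)^-1 : R)).
Proof.
move=> t0; set om := e _.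
have pw j : (j <= t)%N -> om ^+ (2 ^ j) = e ((2 ^+ (t - j))^-1).
  move=> jt; rewrite -eMn; congr e; rewrite -[LHS]mulr_natr natrX.
  by rewrite -{1}(subnK jt) exprD invfM -mulrA mulVf ?mulr1 // expf_neq0 // pnatr_eq0.
have omt : om ^+ (2 ^ t) = 1 by rewrite pw // subnn expr0 invr1 e1.
have t2 : (0 < 2 ^ t)%N by rewrite expn_gt0.
have [m mprim mt] := prim_order_exists t2 omt.
have /(dvdn_pfactor _ _ (isT : prime 2))[j jt mE] := mt.
move: jt; rewrite leq_eqVlt => /orP[/eqP <-|jt]; first by rewrite -mE.
have : om ^+ (2 ^ t.-1) = 1.
  apply/eqP; rewrite -(prim_order_dvd mprim) mE dvdn_exp2l //; lia.
rewrite pw ?leq_pred // (_ : t - t.-1 = 1)%N ?expr1 ?e_half; last by lia.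
by move/eqP; rewrite eq_sym -subr_eq0 opprK -mulr2n pnatr_eq0.
Qed.

Lemma e_psi t (m : int) : (0 < t)%N ->
  e (m%:~R / 2 ^+ t : R) = psi (e ((2 ^+ t)^-1 : R)) (m%:~R : 'Z_(2 ^ t)).
Proof.
move=> t0; have W1 : (1 < 2 ^ t)%N by rewrite -{1}(expn0 2) ltn_exp2l.
have prim := e_prim t0.
have nz : (2 ^+ t : R) != 0 by rewrite expf_neq0 // pnatr_eq0.
have en (n : nat) : e (n%:R / 2 ^+ t : R) = psi (e ((2 ^+ t)^-1 : R)) (n%:R : 'Z_(2 ^
  t)).
  by rewrite mulr_natl eMn /psi val_Zp_nat // prim_expr_mod.
set w := (2 ^ t)%N; have w0 : w%:Z != 0 by rewrite -lt0n expn_gt0.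
have wz : w%:R = 0 :> 'Z_(2 ^ t) by rewrite pchar_Zp.
have : m = (m %/ w)%Z * w%:Z + `|(m %% w)%Z|%N%:Z by rewrite gez0_abs ?modz_ge0 //
  -divz_eq.
move: (m %/ w)%Z `|(m %% w)%Z|%N => q r ->.
by rewrite !rmorphD !rmorphM /= -!pmulrn wz mulr0 add0r mulrDl eD natrX mulfK //
  e_int mul1r en.
Qed.
End UnitCircle.

(** * Comparison of exponents *)

Section Numerics.
Local Open Scope nat_scope.

(** The coefficients of [s k ^ 2] add up to [30 + 80 + 3 = 113], against 114 on the right; the spare
    [s k ^ 2 >= 18000 k ^ 4] absorbs the terms free of [s]. *)
Lemma exponent_budget k s : 7 <= k -> 18 * 1000 * k ^ 2 <= s ->
  s * 'C(k, 2) * 60 + (3 * (k * (3 * k + k * k.+1)) + s * (2 * k ^ 2 + 3 * k + 1)) * 40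
    + 5 * k * ((760 * k ^ 2 * (k + 4) + 19 * k * k.+1) * 3) + s * k ^ 2 * 3
  <= 38 * s * (k * k.+1) * 3.
Proof.
move=> k7 sk; have tri : 2 * 'C(k, 2) = k * k.-1 by rewrite -mul_bin_diag bin1.
have -> : s * 'C(k, 2) * 60 = s * (30 * (k * k.-1)) by rewrite -tri; ring.
have kk : k * k.-1 + k = k * k by rewrite -mulnSr prednK // (leq_trans _ k7).
have k3 : 7 * (k * k * k) <= k * k * k * k by rewrite mulnC leq_mul2l k7 orbT.
have k2 : 7 * 7 * (k * k) <= k * k * k * k.
  by rewrite -[leqRHS]mulnA mulnC leq_mul2l leq_mul ?orbT.
have main : s * (30 * (k * k.-1) + 40 * (2 * (k * k) + 3 * k + 1) + 4 * (k * k)) <= s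
  * (114 * (k * k + k)).
  by rewrite leq_mul2l; apply/orP; right; lia.
have err : 18 * 1000 * (k * k) * (k * k) <= s * (k * k).
  by rewrite leq_mul2r mulnn sk orbT.
have -> : k.+1 = k + 1 by rewrite addn1.
rewrite -!mulnn in sk *.
move: (k * k.-1) kk main => K kk main; clear -k3 k2 main err.
lia.
Qed.

Variables (p k s t P : nat).
Hypotheses (k7 : 7 <= k) (sk : 18 * 1000 * k ^ 2 <= s) (tsk : t <= (s - k) * k)
  (skt : (s - k.+1) * k <= t) (P2 : P <= 2 ^ (2 * s)) (p128 : p <= 128 * k ^ 4).
Let w (j : 'I_k) := 2 ^ (t - expansion_val s j.+1).
Let b := 20 * k ^ 2.
Let n (j : 'I_k) := ((2 * b * P ^ j.+1) %/ w j).+1.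

Let ks : k < s.
Proof. have : k <= k ^ 2 by rewrite -mulnn leq_pmulr //; lia.
lia.
Qed.

(** From [t <= (s - k) k] and [expansion_val s i >= (s - k) i], the order [w] at degree [i] is at
    most [2 ^ (s (k - i))]. *)
Lemma prod_orders_le : \prod_j w j <= 2 ^ (s * 'C(k, 2)).
Proof.
rewrite -expn_sum leq_exp2l // -triangular_sum (reindex_inj rev_ord_inj) /= big_mkord
  big_distrr /=.
apply: leq_sum => j _ /=; rewrite subnSK //.
have := @expansion_val_ge s k (k - j) (leq_subr _ _).
have := ltn_ord j; move: (nat_of_ord j) => i ik.
have h : t <= (s - k) * (k - i) + (s - k) * i by rewrite -mulnDr subnK // ltnW.
have : (s - k) * i <= s * i by rewrite leq_mul2r leq_subr orbT.
lia.
Qed.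

Lemma sum_trunc_le m : 6 * (\sum_(1 <= i < m.+1) (3 * i - k)) <= (3 * m - k) * (3 * m
  - k + 3) + 2.
Proof.
elim: m => [|m IH]; first by rewrite big_geq.
rewrite big_nat_recr //= mulnDr.
have [h|h] := leqP k (3 * m).
  apply: leq_trans (leq_add IH (leqnn _)) _.
  have -> : 3 * m.+1 - k = (3 * m - k) + 3 by lia.
  by move: (3 * m - k) => x; nia.
rewrite big1_seq => [|i /=]; last by rewrite mem_index_iota; lia.
have : 3 * m.+1 - k <= 2 by lia.
by case: (3 * m.+1 - k) => [|[|[|]]].
Qed.

(** At degree [i], [P ^ i <= 2 ^ (2 s i)] is divided by about [2 ^ (s (k - i))], leaving
    [s (3 i - k)]; truncated subtraction makes the box short when [3 i <= k]. *)
Lemma box_size_le (j : 'I_k) :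
  n j <= 2 ^ (3 * k + k * k.+1) * 2 ^ (s * (3 * j.+1 - k)).
Proof.
set i := j.+1; set q := t - expansion_val s i.
have q1 : 2 * s * i - q <= s * (3 * i - k) + k * k.+1.
  have := expansion_val_le s i.
  have h3 : s * k - k.+1 * k <= t by rewrite -mulnBl.
  have [h|h] := leqP k (3 * i).
    have -> : s * (3 * i - k) = 3 * (s * i) - s * k by rewrite mulnBr; lia.
    have : s * k <= s * (3 * i) by rewrite leq_mul2l h orbT.
    by rewrite /q; lia.
  have : s * (3 * i) <= s * k by rewrite leq_mul2l ltnW ?orbT.
  by rewrite /q; lia.
have k2 : k ^ 2 <= 2 ^ (2 * k) by rewrite mulnC expnM leq_exp2r // ltnW // ltn_expl.
have b2 : (2 * b).+1 <= 2 ^ (3 * k).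
  apply: leq_trans (_ : 2 ^ 6 * 2 ^ (2 * k) <= _).
    apply: leq_trans (_ : 2 ^ 6 * k ^ 2 <= _); first by rewrite /b; nia.
    by rewrite leq_mul2l k2 orbT.
  by rewrite -expnD leq_exp2l //; lia.
have P3 : 2 * b * P ^ i %/ w j <= 2 * b * 2 ^ (2 * s * i - q).
  have w0 : 0 < w j by rewrite expn_gt0.
  rewrite -ltnS ltn_divLR // mulSn.
  apply: leq_ltn_trans (_ : _ <= 2 * b * 2 ^ (2 * s * i - q) * w j) _;
    last by rewrite -[X in X < _]add0n ltn_add2r.
  have -> : w j = 2 ^ q by [].
  rewrite -mulnA -expnD leq_mul2l; apply/orP; right.
  apply: leq_trans (_ : 2 ^ (2 * s * i) <= _); last by rewrite leq_exp2l //; lia.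
  by rewrite expnM leq_exp2r.
apply: leq_trans (_ : (2 * b).+1 * 2 ^ (2 * s * i - q) <= _).
  by rewrite mulSn /n -addn1 addnC leq_add ?expn_gt0.
rewrite (expnD 2 (3 * k)) -[leqRHS]mulnA; apply: leq_mul => //.
by rewrite -expnD leq_exp2l // addnC.
Qed.

(** The cube clears the denominator 3 of the sum of the truncated [3 i - k]. *)
Lemma prod_boxes_le :
  (\prod_j n j) ^ 3 <= 2 ^ (3 * (k * (3 * k + k * k.+1)) + s * (2 * k ^ 2 + 3 * k + 1)).
Proof.
apply: leq_trans (_ : (2 ^ (k * (3 * k + k * k.+1)) * 2 ^ (s * \sum_(1 <= i < k.+1)
  (3 * i - k))) ^ 3 <= _).
  rewrite leq_exp2r //.
  apply: leq_trans (_ : \prod_(j < k) (2 ^ (3 * k + k * k.+1) * 2 ^ (s * (3 * j.+1 -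
    k))) <= _).
    by apply: leq_prod => j _; exact: box_size_le.
  rewrite big_split /= prod_nat_const card_ord; apply: leq_mul;
    first by rewrite -expnM mulnC.
  by rewrite -expn_sum leq_exp2l // big_distrr /= big_add1 /= big_mkord.
rewrite -expnD -expnM leq_exp2l //.
have := sum_trunc_le k; move: (\sum_(_ <= _ < _) _) => x.
have -> : 3 * k - k = 2 * k by lia.
have -> : 2 * k * (2 * k + 3) + 2 = 2 * (2 * k ^ 2 + 3 * k + 1) by rewrite -mulnn; ring.
move: (2 * k ^ 2 + 3 * k + 1) (k * (3 * k + _)) => z y h.
have : s * (6 * x) <= s * (2 * z) by rewrite leq_mul2l h orbT.
by clear; lia.
Qed.

Lemma exponent_saving :
  (\prod_j w j) ^ 20 * (\prod_j n j) ^ 40 * p ^ (760 * k ^ 2 * (k + 4) + 19 * k *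
    k.+1) * 2 ^ (s * k ^ 2)
    <= 2 ^ (38 * s * (k * k.+1)).
Proof.
have p5 : p <= 2 ^ (5 * k).
  apply: (leq_trans p128); apply: leq_trans (_ : 2 ^ 7 * (2 ^ k) ^ 4 <= _).
    by rewrite leq_mul2l leq_exp2r // ltnW // ltn_expl.
  by rewrite -expnM -expnD leq_exp2l //; lia.
rewrite -(@leq_exp2r _ _ 3) //.
have -> : forall a c d f : nat, (a ^ 20 * c ^ 40 * d * f) ^ 3 = a ^ 60 * (c ^ 3) ^ 40
  * d ^ 3 * f ^ 3.
  move=> a c d f; rewrite (expnMn _ f) (expnMn _ d) (expnMn (a ^ 20)) -!expnM;
    congr (_ ^ _ * _ ^ _ * _ * _).
have L1 : (\prod_j w j) ^ 60 <= 2 ^ (s * 'C(k, 2) * 60).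
  by rewrite (expnM 2 _ 60) leq_exp2r // prod_orders_le.
have L2 : ((\prod_j n j) ^ 3) ^ 40 <= 2 ^ ((3 * (k * (3 * k + k * k.+1)) + s * (2 * k
  ^ 2 + 3 * k + 1)) * 40).
  by rewrite (expnM 2 _ 40) leq_exp2r // prod_boxes_le.
set E := 760 * k ^ 2 * (k + 4) + 19 * k * k.+1.
have E0 : 0 < E by rewrite addn_gt0 !muln_gt0 (leq_trans _ k7) ?orbT.
have L3 : (p ^ E) ^ 3 <= 2 ^ (5 * k * (E * 3)).
  by rewrite -expnM (expnM 2 (5 * k)) leq_exp2r // muln_gt0 E0.
apply: leq_trans (leq_mul (leq_mul (leq_mul L1 L2) L3) (leqnn _)) _.
rewrite -!expnM -!expnD leq_exp2l //.
exact: exponent_budget.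
Qed.
End Numerics.

(** * Sums over a product of two shifts *)

(** The 20th power matches [V ^ 40] in the mean value theorem, and
    [(p P) ^ K >= 2 ^ (38 s k (k + 1))] for [K = 19 k (k + 1)]. The outcome saves [2 ^ (s k ^ 2)]
    over the trivial bound [P ^ 2] raised to [160 b ^ 2]. *)
Lemma normalized_saving (C : numDomainType) (x : C) (p k s b P Pw Pn V : nat) :
  0 <= x -> (0 < P)%N -> (0 < p)%N -> b = (20 * k ^ 2)%N ->
  x ^+ (8 * b ^ 2) * (P ^ (4 * b))%:R <= (P ^ (16 * b ^ 2) * Pw * (Pn * V) ^ 2)%:R ->
  (V ^ 40 * P ^ (19 * k * k.+1) <= p ^ (760 * k ^ 2 * (k + 4)) * P ^ (1600 * k ^
    2))%N ->
  (2 ^ (2 * s) <= p * P)%N ->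
  (Pw ^ 20 * Pn ^ 40 * p ^ (760 * k ^ 2 * (k + 4) + 19 * k * k.+1) * 2 ^ (s * k ^ 2)
    <= 2 ^ (38 * s * (k * k.+1)))%N ->
  x ^+ (160 * b ^ 2) * (2 ^ (s * k ^ 2))%:R <= (P ^ (320 * b ^ 2))%:R.
Proof.
move=> x0 P0 p0 bE H vm pP ex.
have H20 : x ^+ (160 * b ^ 2) * (P ^ (80 * b))%:R <= (P ^ (320 * b ^ 2) * Pw ^ 20 *
  Pn ^ 40 * V ^ 40)%:R.
  have -> : x ^+ (160 * b ^ 2) * (P ^ (80 * b))%:R = (x ^+ (8 * b ^ 2) * (P ^ (4 *
    b))%:R) ^+ 20.
    rewrite exprMn -exprM -natrX -expnM; congr (_ ^+ _ * (_ ^ _)%:R); lia.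
  have -> : (P ^ (320 * b ^ 2) * Pw ^ 20 * Pn ^ 40 * V ^ 40)%:R = (P ^ (16 * b ^ 2) *
    Pw * (Pn * V) ^ 2)%:R ^+ 20 :> C.
    rewrite -natrX (_ : 320 * b ^ 2 = 16 * b ^ 2 * 20)%N; last by ring.
    by rewrite expnM; congr (_%:R); ring.
  by rewrite lerXn2r // nnegrE ?ler0n // mulr_ge0 ?exprn_ge0 ?ler0n.
set K := (19 * k * k.+1)%N in vm ex.
set E1 := (760 * k ^ 2 * (k + 4))%N in vm ex.
have b80 : (1600 * k ^ 2 = 80 * b)%N by rewrite bE; lia.
rewrite b80 in vm.
have pos : 0 < (P ^ (80 * b) * (p * P) ^ K)%:R :> C by rewrite ltr0n muln_gt0
  !expn_gt0 muln_gt0 P0 p0.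
rewrite -(ler_pM2r pos).
have -> : x ^+ (160 * b ^ 2) * (2 ^ (s * k ^ 2))%:R * (P ^ (80 * b) * (p * P) ^ K)%:R
   = x ^+ (160 * b ^ 2) * (P ^ (80 * b))%:R * (2 ^ (s * k ^ 2) * (p * P) ^ K)%:R.
  by rewrite !natrM; ring.
apply: le_trans (ler_wpM2r (ler0n _ _) H20) _.
rewrite -!natrM ler_nat.
have e1 : (2 ^ (38 * s * (k * k.+1)) <= (p * P) ^ K)%N.
  apply: leq_trans (_ : (2 ^ (2 * s)) ^ K <= _)%N; last first.
    by case: (posnP K) => [->|K0]; rewrite ?expn0 ?leq_exp2r.
  by rewrite -expnM leq_exp2l // /K; lia.
rewrite (expnMn p P).
have -> : (P ^ (320 * b ^ 2) * Pw ^ 20 * Pn ^ 40 * V ^ 40 * (2 ^ (s * k ^ 2) * (p ^ K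
  * P ^ K))
  = P ^ (320 * b ^ 2) * (Pw ^ 20 * Pn ^ 40 * p ^ K * 2 ^ (s * k ^ 2)) * (V ^ 40 * P ^
    K))%N by ring.
apply: leq_trans (leq_mul (leqnn _) vm) _.
have -> : (P ^ (320 * b ^ 2) * (Pw ^ 20 * Pn ^ 40 * p ^ K * 2 ^ (s * k ^ 2)) * (p ^
  E1 * P ^ (80 * b))
  = P ^ (320 * b ^ 2) * P ^ (80 * b) * (Pw ^ 20 * Pn ^ 40 * p ^ (E1 + K) * 2 ^ (s * k
    ^ 2)))%N.
  by rewrite expnD; ring.
rewrite [leqRHS]mulnA leq_mul2l -[(p ^ K * _)%N]expnMn; apply/orP; right.
exact: leq_trans ex e1.
Qed.

Section InnerSum.
Variables (R : realType) (t : nat) (a b c g : 'Z_(2 ^ t)) (beta : nat) (w h : int).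
Hypotheses (t0 : (0 < t)%N) (cg : coprime g 2) (ca : coprime a 2) (b2 : (b = 0 %[mod
  2])%N)
  (beta2 : (2 <= beta)%N) (gE : (g : nat)%:Z ^+ 2 = 1 + w * 2 ^+ beta) (cw : coprimez
    w 2)
  (ch : coprimez h 2).
Variables (k s : nat).
Hypotheses (k0 : (0 < k)%N) (ks : (k < s)%N) (bs : (beta <= s)%N) (tsk : (t <= (s -
  k) * k)%N).

Let om : R[i] := e ((2 ^+ t)^-1).
Let W1 : (1 < 2 ^ t)%N. Proof. by rewrite -{1}(expn0 2) ltn_exp2l. Qed.

Lemma inner_sum_bound n P r : (0 < r)%N ->
  `|\sum_(x < P) \sum_(y < P)
      e (h%:~R * (useq a b c g (n + 2 ^ (s - beta).+1 * (x * y))%N : nat)%:R / 2 ^+ t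
        : R)|
    ^+ (8 * r ^ 2) * (P ^ (4 * r))%:R
  <= (P ^ (16 * r ^ 2) * (\prod_(j < k) 2 ^ (t - expansion_val s j.+1)) *
       ((\prod_(j < k) ((2 * r * P ^ j.+1) %/ 2 ^ (t - expansion_val s j.+1)).+1)
         * vinogradov k r P) ^ 2)%:R.
Proof.
move=> r0.
have [v vu GH] := inverse_of_square_power t0 beta2 bs cg cw gE.
have [b' bE] := even_residue b2.
have gu := odd_unit t0 cg; have au := odd_unit t0 ca; have hu := odd_int_unit t0 ch.
have gnu : g ^+ n \is a GRing.unit by rewrite unitrX.
have [U Uu UE] := inversive_expansion (two_nilpotent t0) vu (ltnW ks) tsk k0 t0 b' au
  gnu.
pose cc (j : 'I_k) : 'Z_(2 ^ t) := h%:~R * U j.+1 * 2 ^+ expansion_val s j.+1.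
have ccw j m : (cc j * m%:R == 0) = (2 ^ (t - expansion_val s j.+1) %| m)%N.
  by rewrite power_of_two_annihilates // unitrM hu Uu.
have w0 (j : 'I_k) : (0 < 2 ^ (t - expansion_val s j.+1))%N by rewrite expn_gt0.
have bound := bilinear_bound W1 (e_prim R t0) P r0 w0 ccw.
apply: le_trans bound.
rewrite ler_wpM2r ?ler0n // lerXn2r ?nnegrE //.
(* The constant term of the expansion and [c] contribute only a factor of modulus 1. *)
pose K0 : 'Z_(2 ^ t) := h%:~R * (U 0%N + c).
rewrite -[leRHS]mul1r -(norm_psi W1 (e_prim R t0) K0) -normrM le_eqVlt; apply/orP;
  left; apply/eqP; congr `|_|.
rewrite mulr_sumr; apply: eq_bigr => x _; rewrite mulr_sumr; apply: eq_bigr => y _.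
rewrite -(psiD W1 (e_prim R t0)).
set u := useq a b c g _.
have -> : h%:~R * (u : nat)%:R / 2 ^+ t = (h * (u : nat)%:Z)%:~R / 2 ^+ t :> R.
  by rewrite rmorphM.
rewrite e_psi //; congr psi.
have uZ : (u : nat)%:Z%:~R = u :> 'Z_(2 ^ t) by rewrite -pmulrn natr_Zp.
rewrite rmorphM /= uZ /u /useq exprD exprM bE (UE _ _ GH).
rewrite big_ord_recl /= mulr1 /K0 !mulrDr addrAC; congr (_ + _ + _).
  by rewrite /expansion_val big_geq // mulr1.
rewrite mulr_sumr; apply: eq_bigr => j _; rewrite /cc /bump /= natrM -!natrX natrM
  exprMn !natrX.
ring.
Qed.
End InnerSum.

(** * Averaging over shifts *)

Lemma norm_shifted_sum_sub (C : numDomainType) (F : nat -> C) N d :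
  (forall n, `|F n| <= 1) ->
  `|\sum_(i < N) F i - \sum_(i < N) F (i + d)%N| <= (2 * d)%:R.
Proof.
move=> F1; elim: d => [|d IH].
  by under [X in _ - X]eq_bigr do rewrite addn0; rewrite subrr normr0.
have E : \sum_(i < N) F (i + d)%N - \sum_(i < N) F (i + d.+1)%N = F d - F (N + d)%N.
  apply/eqP; rewrite subr_eq addrAC -subr_eq opprK -(big_ord_recr N (fun i => F (i +
    d)%N)).
  rewrite big_ord_recl /=; apply/eqP; congr (_ + _).
  by apply: eq_bigr => i _; rewrite /bump /= add1n addSnnS.
rewrite mulnS natrD [leRHS]addrC.
have -> : \sum_(i < N) F i - \sum_(i < N) F (i + d.+1)%N =
  (\sum_(i < N) F i - \sum_(i < N) F (i + d)%N) + (F d - F (N + d)%N) by rewrite -E;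
    ring.
apply: le_trans (ler_normD _ _) (lerD IH _).
by apply: le_trans (ler_normB _ _) _; rewrite mulr2n lerD.
Qed.

(** Each of the [P ^ 2] shifts changes the sum by at most [2 D P ^ 2]; the mean over the shifts is
    bounded after exchanging summations. *)
Lemma averaging (C : numFieldType) (F : nat -> C) (N D P : nat) (delta B : C) :
  (0 < P)%N -> (forall n, `|F n| <= 1) -> (2 * (D * P ^ 2))%:R <= B ->
  (forall n, `|\sum_(x < P) \sum_(y < P) F (n + D * (x * y))%N| <= delta * (P ^
    2)%:R) ->
  `|\sum_(i < N) F i| <= N%:R * delta + B.
Proof.
move=> P0 F1 DB T.
have P2 : 0 < (P ^ 2)%:R :> C by rewrite ltr0n expn_gt0 P0.
rewrite -(ler_pM2l P2) -[X in X * `|_|](gtr0_norm P2) -normrM.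
have -> : (P ^ 2)%:R * (\sum_(i < N) F i) =
   \sum_(x < P) \sum_(y < P) (\sum_(i < N) F i - \sum_(i < N) F (i + D * (x * y))%N)
   + \sum_(i < N) \sum_(x < P) \sum_(y < P) F (i + D * (x * y))%N.
  rewrite [X in _ + X]exchange_big -big_split /=.
  rewrite [RHS](eq_bigr (fun _ => P%:R * \sum_(i < N) F i)) => [|x _].
    by rewrite sumr_const card_ord -[RHS]mulr_natl mulrA -natrM mulnn.
  rewrite [X in _ + X]exchange_big -big_split /=.
  rewrite [LHS](eq_bigr (fun _ => \sum_(i < N) F i)) => [|y _]; last by rewrite subrK.
  by rewrite sumr_const card_ord -[LHS]mulr_natl.
apply: le_trans (ler_normD _ _) _; rewrite mulrDr [leRHS]addrC; apply: lerD.
  apply: le_trans (_ : \sum_(x < P) \sum_(y < P) B <= _); last first.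
    by rewrite !sumr_const card_ord -mulrnA -[leLHS]mulr_natl mulnn.
  apply: le_trans (ler_norm_sum _ _ _) _; apply: ler_sum => x _.
  apply: le_trans (ler_norm_sum _ _ _) _; apply: ler_sum => y _.
  apply: le_trans (norm_shifted_sum_sub _ _ F1) _; apply: le_trans DB; rewrite ler_nat.
  by rewrite leq_mul2l leq_mul2l -mulnn leq_mul ?orbT // ltnW.
apply: le_trans (ler_norm_sum _ _ _) _; apply: le_trans (ler_sum _ (fun (i : 'I_N) _
  => T i)) _.
by rewrite sumr_const card_ord -[leLHS]mulr_natl mulrA mulrC.
Qed.

Section ExpSum.
Variables (R : realType) (t : nat) (a b c g : 'Z_(2 ^ t)) (beta : nat) (w h : int).

Lemma norm_e (x : R) : `|e x| = 1.
Proof. by rewrite eE normc_def /= cos2Dsin2 sqrtr1. Qed.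

Lemma expsum_ord L N : expsum R a b c g h L N =
  \sum_(i < N) e (h%:~R * (useq a b c g (i + L) : nat)%:R / 2 ^+ t : R).
Proof. by rewrite /expsum -{1}[L]add0n big_addn addnC addnK big_mkord. Qed.

Lemma expsum_trivial L N : `|expsum R a b c g h L N| <= N%:R.
Proof.
rewrite expsum_ord; apply: le_trans (ler_norm_sum _ _ _) _.
by under eq_bigr do rewrite norm_e; rewrite sumr_const card_ord.
Qed.

Hypotheses (t0 : (0 < t)%N) (cg : coprime g 2) (ca : coprime a 2) (b2 : (b = 0 %[mod
  2])%N)
  (beta2 : (2 <= beta)%N) (gE : (g : nat)%:Z ^+ 2 = 1 + w * 2 ^+ beta) (cw : coprimez
    w 2)
  (ch : coprimez h 2).
Variables (k s : nat).
Hypotheses (k7 : (7 <= k)%N) (bs : (beta <= s)%N) (tsk : (t <= (s - k) * k)%N)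
  (skt : ((s - k.+1) * k <= t)%N) (sk : (18 * 1000 * k ^ 2 <= s)%N).

Lemma expsum_saving L N (delta : R) : 0 <= delta ->
  1 <= delta ^+ (160 * (20 * k ^ 2) ^ 2) * 2 ^+ (s * k ^ 2) ->
  `|expsum R a b c g h L N| <= (N%:R * delta + 2 ^+ (5 * s))%:C.
Proof.
move=> d0 dk; rewrite expsum_ord.
have k0 : (0 < k)%N by apply: leq_trans k7.
have kk : (k <= k ^ 2)%N by rewrite -mulnn leq_pmulr.
have k2 : (0 < k ^ 2)%N by rewrite expn_gt0 k0.
have ks : (k < s)%N by lia.
have X6 : (6 < 8 * k ^ 2)%N by lia.
have [p [pp pX p2X]] := prime_below_square X6.
have p128 : (p <= 128 * k ^ 4)%N by apply: leq_trans p2X _; rewrite expnMn -expnM mulnA.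
(* [P] is the largest power of [p] up to [2 ^ (2 s)], so at most a factor [p] is lost. *)
pose m := trunc_log p (2 ^ (2 * s)); pose P := (p ^ m)%N.
have p1 := prime_gt1 pp; have p0 := prime_gt0 pp.
have P0 : (0 < P)%N by rewrite expn_gt0 p0.
have P2 : (P <= 2 ^ (2 * s))%N by apply: trunc_logP => //; rewrite expn_gt0.
have pP : (2 ^ (2 * s) <= p * P)%N by rewrite -expnS ltnW // trunc_log_ltn.
have vm := vinogradov_mean_value m pp (leq_trans (isT : 2 <= 7)%N k7) (ltnW pX).
have ex := exponent_saving k7 sk tsk skt P2 p128.
have -> : (N%:R * delta + 2 ^+ (5 * s))%:C = N%:R * delta%:C + (2 ^ (5 * s))%:R :> R[i].
  by rewrite rmorphD rmorphM !rmorph_nat natrX rmorphXn rmorph_nat.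
apply: (@averaging R[i] (fun n => e (h%:~R * (useq a b c g (n + L) : nat)%:R / 2 ^+ t
  : R))
  N (2 ^ (s - beta).+1)%N P delta%:C (2 ^ (5 * s))%:R P0) => [n||n];
    first by rewrite norm_e.
  rewrite ler_nat; apply: leq_trans (_ : 2 * (2 ^ (s - beta).+1 * (2 ^ (2 * s)) ^ 2)
    <= _)%N.
    by rewrite !leq_mul2l leq_exp2r // P2 !orbT.
  (* The shifts cost [2 ^ (5 s + 2 - beta)], and [beta >= 2]. *)
  by rewrite -expnM -expnD -expnS leq_exp2l //; move: beta2 bs; clear; lia.
under eq_bigr do under eq_bigr do rewrite addnAC.
set T := `|_|.
have r0 : (0 < 20 * k ^ 2)%N by rewrite muln_gt0.
have H := inner_sum_bound R c t0 cg ca b2 beta2 gE cw ch k0 ks bs tsk (n + L) P r0.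
have := normalized_saving (normr_ge0 _) P0 p0 (erefl _) H vm pP ex.
rewrite -/T => Ts.
have T0 : 0 <= T by apply: normr_ge0.
have M0 : (0 < 160 * (20 * k ^ 2) ^ 2)%N by rewrite muln_gt0 expn_gt0 r0.
have dC : 0 <= delta%:C by rewrite lecR.
rewrite -(ler_pXn2r M0) ?nnegrE ?mulr_ge0 ?ler0n //.
have two0 : 0 < (2 ^ (s * k ^ 2))%:R :> R[i] by rewrite ltr0n expn_gt0.
rewrite -(ler_pM2r two0); apply: (le_trans Ts).
rewrite exprMn -natrX -expnM mulrAC -[leLHS]mul1r.
have -> : (2 * (160 * (20 * k ^ 2) ^ 2) = 320 * (20 * k ^ 2) ^ 2)%N by rewrite mulnA.
rewrite ler_wpM2r ?ler0n //.
have -> : delta%:C ^+ (160 * (20 * k ^ 2) ^ 2) * (2 ^ (s * k ^ 2))%:R = (delta ^+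
  (160 * (20 * k ^ 2) ^ 2) * 2 ^+ (s * k ^ 2))%:C.
  by rewrite rmorphM !rmorphXn rmorph_nat natrX.
by rewrite -[1]/(1%:C) lecR.
Qed.
End ExpSum.

(** * The bound for the exponential sum *)

Lemma odd_square_sub1_val (g w : int) beta : coprimez g 2 -> coprimez w 2 ->
  g ^+ 2 = 1 + w * 2 ^+ beta -> (2 <= beta)%N.
Proof.
rewrite !coprimez2 => cg cw E; rewrite leqNgt; apply/negP => b1.
have [x gE] : exists x, g = 2 * x + 1.
  exists (g %/ 2)%Z; rewrite {1}(divz_eq g 2) mulrC; congr (_ + _).
  have := modz_ge0 g (isT : (2 : int) != 0); have := ltz_pmod g (isT : 0 < (2 : int)).
  by move: cg; rewrite -[(2 %| g)%Z]/(_ == 0) => /eqP; lia.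
rewrite gE in E; case/negP: cw; case: beta b1 E => [|[|//]] _ E.
  by apply/dvdzP; exists (2 * (x ^+ 2 + x)); move: E; rewrite expr0 mulr1; lia.
by apply/dvdzP; exists (x ^+ 2 + x); move: E; rewrite expr1; lia.
Qed.

Section RealBounds.
Variable R : realType.

Lemma two_pow_le_expR n : (2 : R) ^+ n <= expR n%:R.
Proof.
rewrite -[n%:R]mulr1 expRM_natl lerXn2r ?nnegrE ?expR_ge0 //.
by have := expR_ge1Dx (1 : R); lra.
Qed.

Lemma expR_half_le_two_pow n : expR (n%:R / 2) <= (2 : R) ^+ n.
Proof.
rewrite expRM_natl lerXn2r ?nnegrE ?expR_ge0 // -[2^-1]opprK expRN.
rewrite -[leRHS]invrK lef_pV2 ?posrE ?expR_gt0 ?invr_gt0 //.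
by have := expR_ge1Dx (- 2^-1 : R); lra.
Qed.

(** Here [x] is [t], [n] is the binary logarithm of [N] rounded down, and [E] the exponent to be
    saved. The third bound serves small [s], as [126 * 10 ^ 3] is 7 times the threshold
    [18 * 1000]. *)
Lemma saving_exponent_le (E x n k : R) : 0 < x -> 0 <= n -> n <= x -> 0 <= k -> k * n
  <= 7 * x ->
  E * x ^+ 2 <= 8 * (10 ^+ 9)^-1 * n ^+ 3 ->
  [/\ E <= n / 10 ^+ 8, k ^+ 2 * E <= n / 10 ^+ 6 & n <= 126 * 10 ^+ 3 * k ^+ 2 -> E
    <= 1].
Proof.
move=> x0 n0 nx k0 kn hE.
have x2 : 0 < x ^+ 2 by rewrite exprn_gt0.
have n2 : n ^+ 2 <= x ^+ 2 by rewrite lerXn2r // nnegrE // ltW.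
have kn2 : k ^+ 2 * n ^+ 2 <= 49 * x ^+ 2.
  rewrite -exprMn (_ : 49 * x ^+ 2 = (7 * x) ^+ 2); last by ring.
  by rewrite lerXn2r // nnegrE ?mulr_ge0 // ltW.
have n3 : n ^+ 3 = n * n ^+ 2 by rewrite exprS.
split; last move=> nk.
- rewrite -(ler_pM2r x2); apply: (le_trans hE).
  have : n ^+ 3 <= n * x ^+ 2 by rewrite n3 ler_wpM2l.
  have : 0 <= n * x ^+ 2 by rewrite mulr_ge0 // ltW.
  rewrite [n / _ * _]mulrAC.
  by move: (n * x ^+ 2) (n ^+ 3) => u v; lra.
- rewrite -(ler_pM2r x2) -mulrA.
  apply: le_trans (ler_wpM2l (exprn_ge0 2 k0) hE) _.
  have : k ^+ 2 * n ^+ 3 <= n * (49 * x ^+ 2) by rewrite n3 mulrCA ler_wpM2l.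
  have : 0 <= n * x ^+ 2 by rewrite mulr_ge0 // ltW.
  rewrite [n * (49 * _)]mulrCA [k ^+ 2 * (_ * _)]mulrCA [n / _ * _]mulrAC.
  by move: (k ^+ 2 * n ^+ 3) (n * x ^+ 2) => u v; lra.
- rewrite -(ler_pM2r x2) mul1r; apply: (le_trans hE).
  have : n ^+ 3 <= 126 * 10 ^+ 3 * (49 * x ^+ 2).
    rewrite n3; apply: le_trans (ler_wpM2r (exprn_ge0 2 n0) nk) _.
    by rewrite -[leLHS]mulrA ler_wpM2l // mulr_ge0 // exprn_ge0.
  by move: (n ^+ 3) (x ^+ 2) x2 => u v; lra.
Qed.

Lemma saving_budget (E n s k : R) : 0 <= k -> 0 <= n -> n <= 7 * s -> k ^+ 2 * E <= n
  / 10 ^+ 6 ->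
  160 * (20 * k ^+ 2) ^+ 2 * E <= s * k ^+ 2 / 2.
Proof.
move=> k0 n0 ns kE; have k2 := exprn_ge0 2 k0.
have -> : 160 * (20 * k ^+ 2) ^+ 2 * E = k ^+ 2 * (64 * 10 ^+ 3 * (k ^+ 2 * E)) by ring.
rewrite [leRHS](_ : _ = k ^+ 2 * (s / 2)); last by ring.
by rewrite ler_wpM2l //; move: (k ^+ 2 * E) kE => u; lra.
Qed.

Lemma shift_budget (E n s k : R) : 7 <= k -> 18 * 1000 * k ^+ 2 <= s ->
  6 * s <= n + 6 * k + 6 -> n <= 7 * s -> E <= n / 10 ^+ 8 -> E <= (n - 5 * s) / 2.
Proof.
move=> k7 ks sn ns En.
have : 7 * k <= k ^+ 2 by rewrite expr2 ler_wpM2r //; lra.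
by move: (k ^+ 2) ks => u; lra.
Qed.
End RealBounds.

(** [k] is chosen with [6 t < k nu <= 7 t], and [s - k] is [t / k] rounded up. Then [s] is close to
    at most [nu / 6], which leaves room for the shift error [2 ^ (5 s)] below [2 ^ nu]. *)
Lemma degree_and_scale t nu : (0 < nu <= t)%N ->
  exists k s : nat, [/\ (7 <= k)%N, (k * nu <= 7 * t)%N, (t <= (s - k) * k)%N,
    ((s - k.+1) * k <= t)%N & (nu <= 7 * s)%N && (6 * s <= nu + 6 * k + 6)%N].
Proof.
move=> /andP[nu0 nut]; pose k := (6 * t %/ nu).+1; pose q := ((t + k.-1) %/ k)%N.
have knu : (k * nu <= 7 * t)%N by have := leq_trunc_div (6 * t) nu; rewrite /k; lia.
have tknu : (6 * t < k * nu)%N by exact: ltn_ceil.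
have k7 : (7 <= k)%N by rewrite ltnS leq_divRL // leq_mul2l.
have qk : (q * k <= t + k.-1)%N := leq_trunc_div _ _.
have tq : (t <= q * k)%N by have := ltn_ceil (t + k.-1) (ltn0Sn (6 * t %/ nu));
  rewrite -/k -/q; lia.
have nuq : (nu <= 7 * q)%N by rewrite -(@leq_pmul2l k) // (leq_trans knu) //; lia.
have qnu : (6 * q < nu + 6)%N by rewrite -(@ltn_pmul2l k) // mulnDr; lia.
exists k, (q + k)%N; split => //; first by rewrite addnK.
  by rewrite subnS addnK -subn1 mulnBl; lia.
by rewrite mulnDr (leq_trans nuq) ?leq_addr //=; lia.
Qed.

Lemma primitive_root_Zp_le m (g : 'Z_m) tau : (1 < m)%N -> tau.-primitive_root g ->
  (tau <= m)%N.
Proof.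
move=> m1 pg.
have inj : injective (fun i : 'I_tau => g ^+ i).
  move=> i j /eqP; rewrite (eq_prim_root_expr pg) !modn_small // => /eqP;
    exact: val_inj.
by have := leq_card _ inj; rewrite !card_ord Zp_cast.
Qed.

(* tau.-primitive_root g says that tau is the least positive integer with
   g ^+ tau = 1, i.e. the multiplicative order of g modulo 2 ^ t. *)
Theorem theorem1p1 (R : realType) :
  exists C eta : R, [/\ 0 < C, 0 < eta &
    forall (t : nat) (a b c g : 'Z_(2 ^ t)) (tau beta : nat) (w : int),
      (3 <= t)%N ->
      coprime g 2 -> coprime a 2 -> (b = 0 %[mod 2])%N ->
      tau.-primitive_root g ->
      (g : nat)%:Z ^+ 2 = 1 + w * 2 ^+ beta -> coprimez w 2 ->
      forall (L N : nat) (h : int),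
        (2 ^ (8 * beta) < N <= tau)%N -> coprimez h 2 ->
        let rho : R := ln N%:R / t%:R in
        `|expsum R a b c g h L N| <= (C * N%:R `^ (1 - eta * rho ^+ 2))%:C].
Proof.
(* The factor [expR 1] covers the range where the saving is at most [expR 1] and the trivial bound
   suffices; the 2 adds the main term and the shift error. *)
exists (2 * expR 1), (10 ^+ 9)^-1.
have e1 : 1 <= expR 1 :> R by rewrite -[leLHS]expR0 ler_expR ler01.
split; [by rewrite mulr_gt0 ?expR_gt0|by rewrite invr_gt0 exprn_gt0|].
move=> t a b c g tau beta w t3 cg ca b2 ptau gE cw L N h /andP[Nbeta Ntau] ch;
  cbv zeta; set rho : R := ln N%:R / t%:R.
have t0 : (0 < t)%N by apply: leq_trans t3.
have W1 : (1 < 2 ^ t)%N by rewrite -{1}(expn0 2) ltn_exp2l.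
have beta2 : (2 <= beta)%N.
  by apply: odd_square_sub1_val gE => //; rewrite /coprimez /gcdz /=.
have N0 : (0 < N)%N by apply: leq_ltn_trans Nbeta.
pose nu := trunc_log 2 N.
have nuN : (2 ^ nu <= N)%N by exact: trunc_logP.
have Nnu : (N < 2 ^ nu.+1)%N by exact: trunc_log_ltn.
have nut : (nu <= t)%N.
  rewrite -(@leq_exp2l 2) // (leq_trans nuN) // (leq_trans Ntau) //.
  exact: primitive_root_Zp_le ptau.
have betanu : (8 * beta <= nu)%N.
  by rewrite -ltnS -(@ltn_exp2l 2) // (ltn_trans Nbeta).
have nu0 : (0 < nu)%N by lia.
have nu_t : (0 < nu <= t)%N by rewrite nu0.
have [k [s [k7 knu tsk skt /andP[nus snu]]]] := degree_and_scale nu_t.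
(* The assumption on [N] enters here: [8 beta <= nu <= 7 s]. *)
have bs : (beta <= s)%N by rewrite -(@leq_pmul2l 8) // (leq_trans betanu) //
  (leq_trans nus) // leq_mul2r orbT.
pose l : R := ln N%:R; pose E := (10 ^+ 9)^-1 * rho ^+ 2 * l.
have NR0 : 0 < N%:R :> R by rewrite ltr0n.
have -> : N%:R `^ (1 - (10 ^+ 9)^-1 * rho ^+ 2) = N%:R * expR (- E).
  by rewrite /powR pnatr_eq0 gtn_eqF // -/l mulrBl mul1r expRD lnK ?posrE.
have l0 : 0 <= l by rewrite ln_ge0 // ler1n.
have l2 : l <= 2 * nu%:R.
  rewrite -ler_expR /l lnK ?posrE //.
  apply: le_trans (_ : (2 : R) ^+ nu.+1 <= _); first by rewrite -natrX ler_nat ltnW.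
  apply: le_trans (two_pow_le_expR _ _) _; rewrite ler_expR -natrM ler_nat; lia.
have x0 : 0 < t%:R :> R by rewrite ltr0n.
have Ex : E * t%:R ^+ 2 <= 8 * (10 ^+ 9)^-1 * nu%:R ^+ 3.
  have -> : E * t%:R ^+ 2 = (10 ^+ 9)^-1 * l ^+ 3.
    rewrite /E (_ : rho = l / t%:R) //.
    by move: (t%:R : R) (l : R) x0 => x y x0; field; rewrite gt_eqF.
  rewrite [8 * _]mulrC -mulrA ler_wpM2l ?invr_ge0 ?exprn_ge0 //.
  rewrite (_ : 8 * nu%:R ^+ 3 = (2 * nu%:R) ^+ 3); last by ring.
  by rewrite lerXn2r // nnegrE ?mulr_ge0.
have E0 : 0 <= E by rewrite !mulr_ge0 ?invr_ge0 ?exprn_ge0 ?divr_ge0 // ltW.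
have knuR : k%:R * nu%:R <= 7 * t%:R :> R by rewrite -!natrM ler_nat.
have nutR : nu%:R <= t%:R :> R by rewrite ler_nat.
have [En kE E1] := saving_exponent_le x0 (ler0n _ _) nutR (ler0n _ _) knuR Ex.
have nusR : nu%:R <= 7 * s%:R :> R by rewrite -natrM ler_nat.
(* If [s] is small against [k ^ 2], then [E <= 1] and the trivial bound is enough. *)
have [sk|ks] := leqP (18 * 1000 * k ^ 2) s; last first.
  apply: le_trans (expsum_trivial _ _ _ _ _ _ _ _) _.
  rewrite -(rmorph_nat (real_complex R)) lecR.
  have /E1 {}E1 : nu%:R <= 126 * 10 ^+ 3 * k%:R ^+ 2 :> R.
    apply: (le_trans nusR).
    have : s%:R <= 18 * 1000 * k%:R ^+ 2 :> R by rewrite -natrX -!natrM ler_nat ltnW.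
    by move: (k%:R ^+ 2) (s%:R) => u v; clear; lra.
  have h1 : 1 <= expR 1 * expR (- E).
    by rewrite -expRD -[leLHS]expR0 ler_expR subr_ge0.
  rewrite (_ : _ * (_ * _) = N%:R * (2 * (expR 1 * expR (- E)))); last by ring.
  rewrite ler_peMr ?ler0n //; apply: (le_trans h1).
  by rewrite ler_peMl // ?ler1n // (le_trans ler01).
have skR : 18 * 1000 * k%:R ^+ 2 <= s%:R :> R by rewrite -natrX -!natrM ler_nat.
have k7R : 7 <= k%:R :> R by rewrite ler_nat.
have snuR : 6 * s%:R <= nu%:R + 6 * k%:R + 6 :> R by rewrite -!natrM -!natrD ler_nat.
(* The bound for the inner sums is applied with [delta = exp (- E)], using [exp (1 / 2) <= 2]. *)
have dk : 1 <= expR (- E) ^+ (160 * (20 * k ^ 2) ^ 2) * 2 ^+ (s * k ^ 2).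
  apply: le_trans (ler_wpM2l _ (expR_half_le_two_pow R _));
    last by rewrite exprn_ge0 ?expR_ge0.
  rewrite -expRM_natl -expRD -[leLHS]expR0 ler_expR mulrN addrC subr_ge0.
  rewrite natrM natrX natrM natrX natrM natrX.
  exact: saving_budget (ler0n _ _) (ler0n _ _) nusR kE.
have key := expsum_saving c t0 cg ca b2 beta2 gE cw ch k7 bs tsk skt sk L N (expR_ge0
  _) dk.
apply: (le_trans key); rewrite lecR.
have half := shift_budget k7R skR snuR nusR En.
have s5 : (5 * s <= nu)%N.
  by rewrite -(ler_nat R) natrM -subr_ge0; move: (le_trans E0 half);
    rewrite pmulr_lge0 ?invr_gt0.
have two : 2 ^+ (5 * s) <= N%:R * expR (- E).
  rewrite expRN ler_pdivlMr ?expR_gt0 //.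
  apply: le_trans (_ : 2 ^+ nu <= _); last by rewrite -natrX ler_nat.
  rewrite -(subnKC s5) exprD ler_wpM2l ?exprn_ge0 //.
  by apply: le_trans (expR_half_le_two_pow R _); rewrite ler_expR natrB // natrM.
apply: le_trans (lerD (lexx _) two) _.
rewrite -mulr2n -[leLHS]mulr_natl -mulrA ler_wpM2l // ler_peMl // mulr_ge0 ?expR_ge0 //.
Qed.
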